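(* Let $R$ be an associative ring with identity. Suppose that for some $n\in\mathbb{N}$ the hereditary and complete cotorsion pair $({}^{\perp}(\mathcal{SFI}^{\vee}_n),\ \mathcal{SFI}^{\vee}_n)$ in $\mathrm{Mod}(R)$ is a projective cotorsion pair. Then the hereditary cotorsion pair $(\mathcal{GP},\mathcal{GP}^{\perp})$ is complete; furthermore, the two cotorsion pairs coincide, i.e. $({}^{\perp}(\mathcal{SFI}^{\vee}_n),\mathcal{SFI}^{\vee}_n)=(\mathcal{GP},\mathcal{GP}^{\perp})$.
   Context: All modules are left $R$-modules, $\mathrm{Mod}(R)$ is the category of left $R$-modules, and $\mathbb{N}=\{0,1,2,\dots\}$. $\mathcal{P}(R)$ is the class of projective left $R$-modules. For a class $\mathcal{X}$: $\mathcal{X}^{\perp_1}=\{M:\mathrm{Ext}^1_R(X,M)=0\ \forall X\in\mathcal{X}\}$, $\mathcal{X}^{\perp}=\{M:\mathrm{Ext}^i_R(X,M)=0\ \forall i\ge1,\ X\in\mathcal{X}\}$; left orthogonals ${}^{\perp_1}\mathcal{X}$, ${}^{\perp}\mathcal{X}$ are defined analogously. $\mathcal{SFI}$ is the class of strongly FP-injective modules, i.e. modules $E$ with $\mathrm{Ext}^k_R(F,E)=0$ for all $k\ge1$ and all finitely presented modules $F$. $\mathcal{SFI}^{\vee}_n$ is the class of modules $M$ admitting an exact sequence $0\to M\to E^0\to\cdots\to E^n\to0$ with all $E^i\in\mathcal{SFI}$. It is known that $({}^{\perp}(\mathcal{SFI}^{\vee}_n),\mathcal{SFI}^{\vee}_n)$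 is a hereditary and complete cotorsion pair for every $n$. $\mathcal{GP}$ is the class of Gorenstein projective modules: cycles of acyclic complexes of projective modules that remain exact after applying $\mathrm{Hom}_R(-,P)$ for all $P\in\mathcal{P}(R)$. It is known that $(\mathcal{GP},\mathcal{GP}^{\perp})$ is a hereditary cotorsion pair. A pair $(\mathcal{X},\mathcal{Y})$ is a cotorsion pair if $\mathcal{X}={}^{\perp_1}\mathcal{Y}$ and $\mathcal{Y}=\mathcal{X}^{\perp_1}$; it is complete if for every module $M$ there is an exact sequence $0\to Y\to X\to M\to0$ with $X\in\mathcal{X}$, $Y\in\mathcal{Y}$; it is hereditary if $\mathrm{Ext}^{i}_R(X,Y)=0$ for all $i\ge1$, $X\in\mathcal{X}$, $Y\in\mathcal{Y}$. A projective cotorsion pair is a complete cotorsion pair $(\mathcal{F},\mathcal{W})$ such that $\mathcal{W}$ is thick (closed under direct summands, and whenever two of the three terms of a short exact sequence are in $\mathcal{W}$ so is the third) and $\mathcal{F}\cap\mathcal{W}=\mathcal{P}(R)$. *)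

(* Defs.v *)
From HB Require Import structures.
From mathcomp Require Import all_boot all_order all_algebra.
Set Implicit Arguments.
Unset Strict Implicit.
Unset Printing Implicit Defensive.

Import GRing.Theory.
Local Open Scope ring_scope.

(* [lmodType R] over a [pzRingType] is the type of all left modules over an
   arbitrary (possibly zero, not necessarily commutative) ring with identity. *)
Definition modclass (R : pzRingType) := lmodType R -> Prop.

Definition eq_class (R : pzRingType) (X Y : modclass R) : Prop :=
  forall M, X M <-> Y M.

Definition surjective (A B : Type) (f : A -> B) : Prop :=
  forall y, exists x, f x = y.

Definition exact_at (R : pzRingType) (A B C : lmodType R)
    (f : {linear A -> B}) (g : {linear B -> C}) : Prop :=
  forall y, g y = 0 <-> exists x, f x = y.

Definition short_exact (R : pzRingType) (A B C : lmodType R)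
    (f : {linear A -> B}) (g : {linear B -> C}) : Prop :=
  [/\ injective f, exact_at f g & surjective g].

Definition projective (R : pzRingType) : modclass R := fun P =>
  forall (A B : lmodType R) (g : {linear A -> B}) (f : {linear P -> B}),
    surjective g -> exists h : {linear P -> A}, forall x, g (h x) = f x.

Definition finitely_presented (R : pzRingType) : modclass R := fun M =>
  exists (m n : nat) (f : {linear 'rV[R]_m -> 'rV[R]_n})
         (g : {linear 'rV[R]_n -> M}), exact_at f g /\ surjective g.

Record proj_resolution (R : pzRingType) (X : lmodType R) := ProjResolution {
  res_obj : nat -> lmodType R;
  res_d : forall i, {linear res_obj i.+1 -> res_obj i};
  res_aug : {linear res_obj 0%N -> X};
  res_projective : forall i, projective (res_obj i);
  res_aug_surj : surjective res_aug;
  res_exact0 : exact_at (res_d 0%N) res_aug;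
  res_exactS : forall i, exact_at (res_d i.+1) (res_d i)
}.

(* [cohomology_zero P M i] is H^i(Hom_R(P, M)) = 0: every i-cocycle
   is an i-coboundary. *)
Definition cohomology_zero (R : pzRingType) (X : lmodType R)
    (P : proj_resolution X) (M : lmodType R) (i : nat) : Prop :=
  match i with
  | 0%N => forall f : {linear res_obj P 0%N -> M},
      (forall x, f (res_d P 0%N x) = 0) -> forall x, f x = 0
  | j.+1 => forall f : {linear res_obj P j.+1 -> M},
      (forall x, f (res_d P j.+1 x) = 0) ->
      exists g : {linear res_obj P j -> M}, forall x, f x = g (res_d P j x)
  end.

(* Ext^i_R(X, M) = 0.  The cohomology does not depend on the projective
   resolution, and X has one because Mod(R) has enough projectives. *)
Definition Ext_zero (R : pzRingType) (i : nat) (X M : lmodType R) : Prop :=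
  forall P : proj_resolution X, cohomology_zero P M i.

Definition right_perp1 (R : pzRingType) (X : modclass R) : modclass R :=
  fun M => forall A, X A -> Ext_zero 1%N A M.

Definition left_perp1 (R : pzRingType) (Y : modclass R) : modclass R :=
  fun M => forall B, Y B -> Ext_zero 1%N M B.

Definition right_perp (R : pzRingType) (X : modclass R) : modclass R :=
  fun M => forall i A, (1 <= i)%N -> X A -> Ext_zero i A M.

Definition left_perp (R : pzRingType) (Y : modclass R) : modclass R :=
  fun M => forall i B, (1 <= i)%N -> Y B -> Ext_zero i M B.

Definition strongly_FP_injective (R : pzRingType) : modclass R := fun E =>
  forall k F, (1 <= k)%N -> finitely_presented F -> Ext_zero k F E.

(* Modules M with an exact sequence 0 -> M -> E^0 -> ... -> E^n -> 0, all E^i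
   in X.  The final 0 is E^{n+1}; nothing is required of the data beyond it. *)
Definition finite_coresolution (R : pzRingType) (X : modclass R) (n : nat) :
    modclass R := fun M =>
  exists (E : nat -> lmodType R) (e : {linear M -> E 0%N})
         (d : forall i, {linear E i -> E i.+1}),
    [/\ forall i, (i <= n)%N -> X (E i),
        forall x : E n.+1, x = 0,
        injective e,
        exact_at e (d 0%N)
      & forall i, (i < n)%N -> exact_at (d i) (d i.+1)].

Definition SFI_vee (R : pzRingType) (n : nat) : modclass R :=
  finite_coresolution (@strongly_FP_injective R) n.

(* Exactness is imposed at P (i + 1) for every integer i, hence everywhere.
   M is, up to isomorphism, the module of cycles ker (d k) for some k. *)
Definition Gorenstein_projective (R : pzRingType) : modclass R := fun M =>
  exists (P : int -> lmodType R) (d : forall i, {linear P i -> P (i + 1)}),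
    [/\ forall i, projective (P i),
        forall i, exact_at (d i) (d (i + 1)),
        forall (Q : lmodType R) (i : int) (f : {linear P (i + 1) -> Q}),
          projective Q -> (forall x, f (d i x) = 0) ->
          exists g : {linear P (i + 1 + 1) -> Q},
            forall x, f x = g (d (i + 1) x)
      & exists k (j : {linear M -> P k}), injective j /\ exact_at j (d k)].

Definition cotorsion_pair (R : pzRingType) (X Y : modclass R) : Prop :=
  eq_class X (left_perp1 Y) /\ eq_class Y (right_perp1 X).

Definition complete_pair (R : pzRingType) (X Y : modclass R) : Prop :=
  forall M : lmodType R,
    exists (B A : lmodType R) (f : {linear B -> A}) (g : {linear A -> M}),
      [/\ Y B, X A & short_exact f g].

Definition hereditary_pair (R : pzRingType) (X Y : modclass R) : Prop :=
  forall i A B, (1 <= i)%N -> X A -> Y B -> Ext_zero i A B.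

Definition closed_under_summands (R : pzRingType) (W : modclass R) : Prop :=
  forall (M N : lmodType R) (s : {linear M -> N}) (r : {linear N -> M}),
    cancel s r -> W N -> W M.

Definition thick (R : pzRingType) (W : modclass R) : Prop :=
  closed_under_summands W /\
  forall (A B C : lmodType R) (f : {linear A -> B}) (g : {linear B -> C}),
    short_exact f g ->
    [/\ W A -> W B -> W C, W A -> W C -> W B & W B -> W C -> W A].

Definition projective_cotorsion_pair (R : pzRingType) (F W : modclass R) :
    Prop :=
  [/\ cotorsion_pair F W, complete_pair F W, thick W
    & eq_class (fun M => F M /\ W M) (@projective R)].

(* Main.v *)
Require Import Defs.
From HB Require Import structures.
From mathcomp Require Import all_boot all_order all_algebra.
From mathcomp Require Import boolp classical_sets functions.

(** Everything rests on the following fact, valid over every ring: if P is an exact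
    complex of projective modules and E is strongly FP-injective, then Hom(P, E)
    is exact ([projective_complex_SFI]).

    Every cosyzygy of E in an injective coresolution E -> I^0 -> I^1 -> ... is again
    strongly FP-injective, so the coresolution X is pure exact: it stays exact
    under Hom(F, -) for F finitely presented.  A map to E from a term of P that
    vanishes on boundaries extends to a chain map from P to X because the I^k are
    injective, and a null homotopy of this chain map contains the wanted
    extension.  So it suffices that every chain map from a complex of projectives
    to a pure exact complex is null homotopic, a fact that goes back to Neeman's
    work on the homotopy category of flat modules.  Here the complexes are bounded
    on the left.  A complex of projectives is a retract of a complex of free
    modules, and a complex of free modules is exhausted by subcomplexes spanned by
    parts of its bases.  Zorn's lemma, applied to homotopies defined on such
    subcomplexes, reduces the claim to complexes that are finitely generated free
    in each degree ([null_homotopy_free]), since a single basis element generates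
    a subcomplex of this kind.  There the homotopy is built degree by degree
    ([homotopy_step]).

    Dimension shifting replaces E by any Y in SFI_vee n, whence Ext^1(G, Y) = 0 for
    every Gorenstein projective G, that is, GP is contained in the left half F of
    the given cotorsion pair ([Gorenstein_projective_ext1]).  Conversely, F is
    closed under syzygies, and Salce's pullback argument embeds every module of F
    into a projective one with cokernel in F, because F and W = SFI_vee n meet in
    the projectives.  Splicing both gives, for every module of F, a complete
    resolution with cycles in F, and Hom into a projective keeps it exact since
    projectives belong to W ([Gorenstein_projective_of_cotorsion]).  So F = GP, and
    W is the right orthogonal of F. *)

Set Implicit Arguments.
Unset Strict Implicit.
Unset Printing Implicit Defensive.

Import GRing.Theory Num.Theory.
Local Open Scope ring_scope.
Local Open Scope quotient_scope.

(** * Linear maps, submodules and quotients *)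

Lemma linear_exists (R : pzRingType) (A B : lmodType R) (f : A -> B) :
  (forall a u v, f (a *: u + v) = a *: f u + f v) ->
  exists h : {linear A -> B}, forall x, h x = f x.
Proof.
move=> lin_f.
by exists (HB.pack_for {linear A -> B} f
  (GRing.isLinear.Build R A B *:%R f lin_f)).
Qed.

(** Linear maps are often determined only through non-unique lifts; describing
    them by their graph replaces choosing a lift and checking independence. *)
Lemma linear_of_graph (R : pzRingType) (A B : lmodType R) (G : A -> B -> Prop) :
  (forall x, exists y, G x y) ->
  (forall a x y x' y', G x y -> G x' y' -> G (a *: x + x') (a *: y + y')) ->
  (forall y, G 0 y -> y = 0) ->
  exists h : {linear A -> B}, forall x y, G x y <-> h x = y.
Proof.
move=> totG linG funG.
have uniqG x y y' : G x y -> G x y' -> y = y'.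
  move=> Gy Gy'; have := linG (-1) _ _ _ _ Gy Gy'.
  rewrite !scaleN1r addNr => /funG.
  by rewrite addrC => /eqP; rewrite subr_eq0 => /eqP.
have [f Gf] := choice totG.
have [a u v|h hE] := @linear_exists R A B f.
  exact: (uniqG (a *: u + v)) (Gf _) (linG _ _ _ _ _ (Gf u) (Gf v)).
exists h => x y; split=> [Gxy|<-]; last by rewrite hE.
by rewrite hE; exact: (uniqG x) (Gf x) Gxy.
Qed.

Lemma factor_surj (R : pzRingType) (A B C : lmodType R)
    (g : {linear A -> B}) (f : {linear A -> C}) :
  surjective g -> (forall x, g x = 0 -> f x = 0) ->
  exists h : {linear B -> C}, forall x, h (g x) = f x.
Proof.
move=> surj_g ker_gf.
have [x|a x y x' y' [u [<- <-]] [v [<- <-]]|y [u [/ker_gf fu0 <-]] //|h hE] :=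
    @linear_of_graph R B C (fun x y => exists u, g u = x /\ f u = y).
- by have [u <-] := surj_g x; exists (f u), u.
- by exists (a *: u + v); rewrite !linearP.
by exists h => x; apply/hE; exists x.
Qed.

Lemma factor_inj (R : pzRingType) (A B C : lmodType R)
    (i : {linear B -> C}) (f : {linear A -> C}) :
  injective i -> (forall x, exists y, i y = f x) ->
  exists h : {linear A -> B}, forall x, i (h x) = f x.
Proof.
move=> inj_i im_f.
have [//|a x y x' y' e e'|y|h hE] :=
    @linear_of_graph R A B (fun x y => i y = f x).
- by rewrite !linearP e e'.
- by rewrite linear0 -[RHS](linear0 i) => /inj_i.
by exists h => x; apply/hE.
Qed.

Definition submodule (R : pzRingType) (A : lmodType R) (S : A -> Prop) :=
  S 0 /\ forall a u v, S u -> S v -> S (a *: u + v).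

Section Submodule.
Variables (R : pzRingType) (A : lmodType R) (S : A -> Prop).
Hypothesis subS : submodule S.

Definition submod_pred : pred A := fun x => `[< S x >].

Let closedS : GRing.submod_closed submod_pred.
Proof.
case: subS => S0 SP; split; first exact/asboolP.
by move=> a u v /asboolP Su /asboolP Sv; apply/asboolP/SP.
Qed.

HB.instance Definition _ := GRing.isSubmodClosed.Build R A submod_pred closedS.

Definition submod := {x : A | submod_pred x}.
HB.instance Definition _ := [isSub of submod for sval].
HB.instance Definition _ := [Choice of submod by <:].
HB.instance Definition _ := [SubChoice_isSubLmodule of submod by <:].

Lemma submodule_exists : exists (K : lmodType R) (i : {linear K -> A}),
  injective i /\ forall x, S x <-> exists k, i k = x.
Proof.
exists submod, (\val : submod -> A); split; first exact: val_inj.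
move=> x; split=> [Sx|[k <-]]; last exact/asboolP/(valP k).
have Sx' : submod_pred x by apply/asboolP.
by exists (exist _ x Sx' : submod).
Qed.

Let ideal : zmodClosed A :=
  HB.pack_for (zmodClosed A) submod_pred
    (GRing.isSubmodClosed.Build R A submod_pred closedS).

Definition quotmod := Quotient.quot ideal.
HB.instance Definition _ := GRing.Zmodule.on quotmod.

Let pi : A -> quotmod := \pi_(Quotient.quot ideal).
Let pi0 x : pi x = 0 <-> S x.
Proof.
have <- : pi 0 = 0 by exact: raddf0.
split=> [/eqP|Sx]; last apply/eqP.
  by rewrite -Quotient.idealrBE subr0 => /asboolP.
by rewrite -Quotient.idealrBE subr0; apply/asboolP.
Qed.
Let piD x y : pi (x + y) = pi x + pi y.
Proof. exact: raddfD. Qed.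
Let piK (q : quotmod) : pi (repr q) = q.
Proof. exact: reprK. Qed.

Let qscale (a : R) (q : quotmod) : quotmod := pi (a *: repr q).
Let pi_eq x y : S (x - y) -> pi x = pi y.
Proof.
move=> /pi0; rewrite piD => e; rewrite -[x](subrK y) piD.
by rewrite piD e add0r.
Qed.
Let piZ a x : qscale a (pi x) = pi (a *: x).
Proof.
apply: pi_eq; rewrite -scalerBr.
case: subS => S0 SP; rewrite -[_ *: _]addr0; apply: SP => //.
apply/pi0; rewrite piD.
have -> : pi (repr (pi x)) = pi x by rewrite piK.
by rewrite -piD subrr; apply/pi0.
Qed.

Let qscaleA a b q : qscale a (qscale b q) = qscale (a * b) q.
Proof. by rewrite -(piK q) !piZ scalerA. Qed.
Let qscale1 : left_id 1 qscale.
Proof. by move=> q; rewrite -(piK q) piZ scale1r. Qed.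
Let qscaleDr : right_distributive qscale +%R.
Proof. by move=> a q r; rewrite -(piK q) -(piK r) -piD !piZ scalerDr piD. Qed.
Let qscaleDl q : {morph qscale^~ q : a b / a + b}.
Proof. by move=> a b; rewrite -(piK q) !piZ scalerDl piD. Qed.

HB.instance Definition _ := GRing.Zmodule_isLmodule.Build R quotmod
  qscaleA qscale1 qscaleDr qscaleDl.

Lemma quotient_exists : exists (Q : lmodType R) (p : {linear A -> Q}),
  surjective p /\ forall x, p x = 0 <-> S x.
Proof.
have [a u v|p pE] := @linear_exists R A quotmod pi; first by rewrite piD -piZ.
exists quotmod, p; split=> [q|x]; last by rewrite pE.
by exists (repr q); rewrite pE piK.
Qed.

End Submodule.

Lemma kernel_exists (R : pzRingType) (A B : lmodType R) (f : {linear A -> B}) :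
  exists (K : lmodType R) (i : {linear K -> A}), injective i /\ exact_at i f.
Proof.
apply: submodule_exists; split; first exact: linear0.
by move=> a u v fu fv; rewrite linearP fu fv scaler0 addr0.
Qed.

Lemma cokernel_exists (R : pzRingType) (A B : lmodType R) (f : {linear A -> B}) :
  exists (C : lmodType R) (p : {linear B -> C}), exact_at f p /\ surjective p.
Proof.
have [|C [p [surj_p kp]]] := @quotient_exists R B (fun y => exists x, f x = y).
  split; first by exists 0; rewrite linear0.
  by move=> a _ _ [u <-] [v <-]; exists (a *: u + v); rewrite linearP.
by exists C, p.
Qed.

Lemma dependent_choice (T : nat -> Type) (P : forall n, T n -> Prop)
    (Q : forall n, T n -> T n.+1 -> Prop) :
  (exists x, P 0%N x) ->
  (forall n x, P n x -> exists y, P n.+1 y /\ Q n x y) ->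
  exists u : forall n, T n, forall n, P n (u n) /\ Q n (u n) (u n.+1).
Proof.
move=> /cid[x0 Px0] step.
pose next n (x : {x : T n | P n x}) : {y : T n.+1 | P n.+1 y /\ Q n (sval x) y} :=
  cid (step n (sval x) (svalP x)).
pose u := fix u n : {x : T n | P n x} :=
  match n with
  | 0 => exist _ x0 Px0
  | m.+1 => exist _ (sval (next m (u m))) (svalP (next m (u m))).1
  end.
exists (fun n => sval (u n)) => n; split; first exact: svalP.
exact: (svalP (next n (u n))).2.
Qed.

(** * Enough injective modules *)

(** Zorn's lemma for a preorder in which only nonempty chains are bounded; the
    empty chain is bounded by [t0]. *)
Lemma zorn_above (T : Type) (R : T -> T -> Prop) (t0 : T) :
  (forall t, R t t) -> (forall r s t, R r s -> R s t -> R r t) ->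
  (forall (A : T -> Prop) s, A s ->
     (forall s t, A s -> A t -> R s t \/ R t s) ->
     exists t, forall s, A s -> R s t) ->
  exists t, forall s, R t s -> R s t.
Proof.
move=> reflR transR ubR.
have [t|r s t /asboolP rs /asboolP st|A totA|t max_t] :=
    @ZL_preorder T t0 (fun s t => `[< R s t >]).
- exact/asboolP.
- exact/asboolP/(transR _ s).
- have [[s As]|noA] := pselect (exists s, A s); last first.
    by exists t0 => s As; case: noA; exists s.
  have [|t ub_t] := ubR A s As.
    by move=> u v Au Av; case: (totA u v Au Av) => /asboolP; [left|right].
  by exists t => u Au; apply/asboolP/ub_t.
by exists t => s ts; apply/asboolP/max_t/asboolP.
Qed.

Lemma int_ideal_principal (I : int -> Prop) : I 0 ->
  (forall a u v, I u -> I v -> I (a * u + v)) ->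
  exists k : nat, forall n, I n <-> (k%:Z %| n)%Z.
Proof.
move=> I0 IP.
have [[k0 [k0_gt0 Ik0]]|noI] := pselect (exists k : nat, (0 < k)%N /\ I k).
  have exk : exists k : nat, `[< (0 < k)%N /\ I k >].
    by exists k0; apply/asboolP.
  have [k /asboolP[k_gt0 Ik] k_min] := ex_minnP exk.
  exists k => n; split=> [In|/dvdzP[q ->]]; last first.
    by rewrite -[_ * _]addr0; apply: IP.
  have k_neq0 : k%:Z != 0 by rewrite eqz_nat -lt0n.
  apply/dvdz_mod0P; apply/eqP; apply: contraT => r_neq0.
  have := modz_ge0 n k_neq0; have := ltz_pmod n (_ : 0 < k%:Z).
  rewrite ltz_nat => /(_ k_gt0).
  case def_r: (n %% k)%Z r_neq0 => [r|//].
  rewrite eqz_nat -lt0n => r_gt0 r_lt _.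
  have Ir : I r%:Z.
    rewrite -def_r; have -> : (n %% k)%Z = - (n %/ k)%Z * k%:Z + n.
      by apply/eqP; rewrite mulNr addrC eq_sym subr_eq addrC -divz_eq.
    exact: IP.
  have /k_min : `[< (0 < r)%N /\ I r >] by apply/asboolP.
  by rewrite leqNgt -ltz_nat r_lt.
exists 0%N => n; split=> [In|]; last by rewrite dvd0z => /eqP->.
rewrite dvd0z; apply: contraT => n_neq0; case: noI; exists `|n|%N.
rewrite absz_gt0 n_neq0; split=> //.
have -> : `|n|%N%:Z = sgz n * n + 0 by rewrite abszEsg addr0.
exact: IP.
Qed.

Definition divisible (D : lmodType int) :=
  forall (k : nat) (y : D), (0 < k)%N -> exists z, k%:Z *: z = y.

(** Baer's argument, for abelian groups: a maximal functional relation that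
    contains the pairs (d x, f x) is total.  If [b] were outside its domain, the
    integers n with n b in the domain form an ideal (k), divisibility gives a
    value y for b that is compatible with the value at k b, and the relation
    could be enlarged. *)
Lemma divisible_extension (D A B : lmodType int)
    (d : {linear A -> B}) (f : {linear A -> D}) :
  divisible D -> (forall x, d x = 0 -> f x = 0) ->
  exists g : {linear B -> D}, forall x, g (d x) = f x.
Proof.
move=> divD ker_df.
pose good (G : B -> D -> Prop) := [/\ forall x, G (d x) (f x),
  forall a x y x' y', G x y -> G x' y' -> G (a *: x + x') (a *: y + y')
  & forall y, G 0 y -> y = 0].
pose le (G H : {G | good G}) := forall x y, sval G x y -> sval H x y.
have good0 : good (fun x y => exists u, d u = x /\ f u = y).
  split=> [u|a x y x' y' [u [<- <-]] [v [<- <-]]|y [u [/ker_df fu0 <-]] //].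
    by exists u.
  by exists (a *: u + v); rewrite !linearP.
have [G x y //|G H K GH HK x y /GH /HK //|A0 G0 A0G0 totA|G maxG] :=
    @zorn_above _ le (exist _ _ good0).
  have goodU : good (fun x y => exists2 G, A0 G & sval G x y).
    split=> [x|a x y x' y' [G AG Gxy] [H AH Hxy]|y [[G gG] /= _]].
    - by exists G0 => //; case: (svalP G0).
    - case: (totA G H AG AH) => le_GH; [exists H => //|exists G => //].
        by case: (svalP H) => _ + _; apply=> //; apply: le_GH.
      by case: (svalP G) => _ + _; apply=> //; apply: le_GH.
    - by case: gG => _ _; apply.
  by exists (exist _ _ goodU) => G AG x y Gxy /=; exists G.
case: G maxG => G gG maxG; have [Gdf Glin G0'] := gG.
have G00 : G 0 0 by have := Gdf 0; rewrite !linear0.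
have [|//|//|h hE] := @linear_of_graph int B D G; last first.
  by exists h => x; apply/hE.
move=> b; have [||k kP] := @int_ideal_principal (fun n => exists y, G (n *: b) y).
- by exists 0; rewrite scale0r.
- move=> a u v [y Gy] [z Gz]; exists (a *: y + z).
  by rewrite scalerDl -scalerA; apply: Glin.
have [y yP] : exists y, G (k%:Z *: b) (k%:Z *: y).
  have [z Gz] : exists z, G (k%:Z *: b) z by apply/kP.
  case: (posnP k) Gz => [->|/divD divk]; last first.
    by case: (divk z) => y <-; exists y.
  by move=> _; exists 0; rewrite !scale0r.
have uniqG n z : G (n *: b) z -> z = n *: y.
  move=> Gz; have /dvdzP[q def_n] : (k%:Z %| n)%Z by apply/kP; exists z.
  have := Glin (- q) _ _ _ _ yP Gz.
  rewrite !scalerA mulNr -def_n -scalerDl addNr scale0r => /G0'.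
  by rewrite scaleNr addrC => /eqP; rewrite subr_eq0 => /eqP.
pose G' x z := exists x' z' (n : int),
  [/\ G x' z', x = x' + n *: b & z = z' + n *: y].
have goodG' : good G'.
  split=> [x|a _ _ _ _ [x [z [n [Gxz -> ->]]]] [x' [z' [n' [Gxz' -> ->]]]]|].
  - by exists (d x), (f x), 0; rewrite !scale0r !addr0.
  - exists (a *: x + x'), (a *: z + z'), (a * n + n'); split; first exact: Glin.
      by rewrite scalerDr scalerDl -scalerA addrACA.
    by rewrite scalerDr scalerDl -scalerA addrACA.
  - move=> z [x' [z' [n [Gxz /esym/eqP]]]].
    rewrite addr_eq0 -scaleNr => /eqP def_x ->.
    by move: Gxz; rewrite def_x => /uniqG ->; rewrite scaleNr addNr.
(* [G'] extends [G] and relates [b] to [y], so by maximality [G] already does. *)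
exists y; apply: (maxG (exist _ _ goodG')).
  by move=> x z Gxz; exists x, z, 0; rewrite !scale0r !addr0.
by exists 0, 0, 1; rewrite !scale1r !add0r.
Qed.

(** Q/Z: a nonzero element of an abelian group generates a cyclic group whose
    order is not 1, and Q/Z has a nonzero element killed by that order. *)
Lemma divisible_cogenerator : exists D : lmodType int, divisible D /\
  forall (B : lmodType int) (m : B), m <> 0 ->
  exists chi : {linear B -> D}, chi m <> 0.
Proof.
have [|D [p [surj_p ker_p]]] :=
  @quotient_exists int (zmodule rat) (fun x : rat => exists n : int, x = n%:~R).
  split; first by exists 0.
  move=> a _ _ [n ->] [n' ->]; exists (a * n + n').
  by rewrite scalezrE -mulrzr rmorphD rmorphM /= mulrC.
have divD : divisible D.
  move=> k y k_gt0; have [x <-] := surj_p y; exists (p ((x : rat) / k%:R)).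
  rewrite -linearZ; congr (p _); rewrite scalezrE -mulrzr /= pmulrn divfK //.
  by rewrite intr_eq0 eqz_nat -lt0n.
exists D; split=> // B m m_neq0.
have [||k kP] := @int_ideal_principal (fun n => n *: m = 0).
- exact: scale0r.
- by move=> a u v um vm; rewrite scalerDl -scalerA um vm scaler0 addr0.
have k_neq1 : k <> 1%N.
  by move=> k1; apply: m_neq0; rewrite -[m]scale1r; apply/kP; rewrite k1 dvd1z.
have pinv (j : nat) : (1 < j)%N -> p ((j%:R : rat)^-1 : zmodule rat) <> 0.
  move=> j_gt1 /ker_p[n] /(congr1 (fun x => x * j%:R)).
  have j_neq0 : (j%:R : rat) != 0 by rewrite pnatr_eq0 -lt0n ltnW.
  rewrite mulVf // pmulrn -intrM -[1]/(1%:~R) => /intr_inj/esym n_j.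
  have : (j%:Z %| 1)%Z by apply/dvdzP; exists n.
  by rewrite dvdzE /= dvdn1 => /eqP j1; rewrite j1 in j_gt1.
(* The order k is 0 for infinite order; otherwise 1/k has order k modulo Z. *)
have [y [y_neq0 ky]] : exists y : D, y <> 0 /\ k%:Z *: y = 0.
  case: k k_neq1 {kP} => [|[|k]] // _.
    by exists (p ((2%:R : rat)^-1)); split; [apply: pinv|rewrite scale0r].
  exists (p ((k.+2%:R : rat)^-1)); split; first exact: pinv.
  rewrite -linearZ; apply/ker_p; exists 1.
  by rewrite scalezrE -mulrzr /= -pmulrn mulVf // pnatr_eq0.
have linZ (V : lmodType int) (v : V) a (u w : int^o) :
    (a *: u + w) *: v = a *: (u *: v) + w *: v by rewrite scalerDl -scalerA.
have [d dE] := linear_exists (linZ B m).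
have [f fE] := linear_exists (linZ D y).
have [n|chi chiE] := divisible_extension (d := d) (f := f) divD.
  rewrite dE fE => /kP/dvdzP[q ->].
  by rewrite -scalerA ky scaler0.
by exists chi; have := chiE 1; rewrite dE fE !scale1r => ->.
Qed.

(** Extension along an arbitrary map [d], injective or not, of the maps that
    vanish on its kernel.  In this form injectivity applies to the differentials
    of an exact complex without passing to their images. *)
Definition injective_module (R : pzRingType) (I : lmodType R) :=
  forall (A B : lmodType R) (d : {linear A -> B}) (f : {linear A -> I}),
  (forall x, d x = 0 -> f x = 0) ->
  exists g : {linear B -> I}, forall x, g (d x) = f x.

(** The R-module of additive maps R -> D, on which R acts by translating the
    argument on the right.  Additive maps B -> D correspond to R-linear maps from
    B to it, which transfers injectivity of [D] over the integers to R. *)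
Section CoinducedModule.
Variables (R : pzRingType) (D : lmodType int).

Definition additive_pred : pred (R -> D) := fun phi =>
  `[< forall a b, phi (a + b) = phi a + phi b >].

Let closed_additive : zmod_closed additive_pred.
Proof.
split=> [|f g /asboolP fD /asboolP gD]; apply/asboolP => a b.
  by rewrite /GRing.zero /= addr0.
have subE x : (f - g) x = f x - g x by [].
by rewrite !subE fD gD opprD addrACA.
Qed.

HB.instance Definition _ :=
  GRing.isZmodClosed.Build (R -> D) additive_pred closed_additive.

Definition coinduced := {phi : R -> D | additive_pred phi}.
HB.instance Definition _ := [isSub of coinduced for sval].
HB.instance Definition _ := [Choice of coinduced by <:].
HB.instance Definition _ := [SubChoice_isSubZmodule of coinduced by <:].

Lemma coinducedD (phi : coinduced) a b :
  sval phi (a + b) = sval phi a + sval phi b.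
Proof. by case: phi => phi /= /asboolP. Qed.

Lemma coscale_subproof (a : R) (phi : coinduced) :
  additive_pred (fun x => sval phi (x * a)).
Proof. by apply/asboolP => x y; rewrite mulrDl coinducedD. Qed.

Definition coscale (a : R) (phi : coinduced) : coinduced :=
  exist (fun f => additive_pred f) _ (coscale_subproof a phi).

Let coscaleA a b phi : coscale a (coscale b phi) = coscale (a * b) phi.
Proof. by apply/val_inj/funext => x /=; rewrite mulrA. Qed.
Let coscale1 : left_id 1 coscale.
Proof. by move=> phi; apply/val_inj/funext => x /=; rewrite mulr1. Qed.
Let coscaleDr : right_distributive coscale +%R.
Proof. by move=> a f g; apply/val_inj/funext. Qed.
Let coscaleDl phi : {morph coscale^~ phi : a b / a + b}.
Proof.
by move=> a b; apply/val_inj/funext => x /=; rewrite mulrDr coinducedD.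
Qed.

HB.instance Definition _ := GRing.Zmodule_isLmodule.Build R coinduced
  coscaleA coscale1 coscaleDr coscaleDl.

(** Evaluation at 1 turns [f] into a family of additive maps to [D]; extend them
    to [g t] and send x to r |-> g t (r x). *)
Lemma coinduced_injective (T : Type) : divisible D ->
  injective_module (T -> coinduced : lmodType R).
Proof.
move=> divD A B d f ker_df.
have evZ (t : T) (phi : T -> coinduced) (n : int) :
    sval ((phi *~ n) t) 1 = n *: sval (phi t) 1.
  have evM (k : nat) : sval ((phi *+ k) t) 1 = sval (phi t) 1 *+ k.
    by elim: k => [|k IHk] //; rewrite !mulrS -IHk.
  case: n => k; first by rewrite -pmulrn evM -[k%:Z]natz scaler_nat.
  by rewrite NegzE mulrNz -pmulrn scaleNr -[k.+1%:Z]natz scaler_nat -evM.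
have [g gE] : {g : T -> {linear zmodule B -> D} &
    forall t (x : A), g t (d x) = sval (f x t) 1}.
  apply: (@choice _ _ (fun t (g : {linear zmodule B -> D}) =>
    forall x : A, g (d x) = sval (f x t) 1)) => t.
  have [a u v|dZ dZE] := @linear_exists int (zmodule A) (zmodule B) d.
    by rewrite !scalezrE raddfD raddfMz.
  have [a u v|ft ftE] := @linear_exists int (zmodule A) D (fun x => sval (f x t) 1).
    by rewrite scalezrE raddfD raddfMz -evZ.
  have [x|g gE] := divisible_extension (d := dZ) (f := ft) divD.
    by rewrite dZE ftE => /ker_df ->.
  by exists g => x; rewrite -dZE gE ftE.
have addh t (x : B) : additive_pred (fun r => g t (r *: x)).
  by apply/asboolP => a b; rewrite scalerDl raddfD.
pose h (x : B) t : coinduced := exist (fun f => additive_pred f) _ (addh t x).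
have [a u v|H HE] := @linear_exists R B (T -> coinduced) h.
  apply/funext => t; apply/val_inj/funext => r /=.
  by rewrite scalerDr raddfD scalerA.
exists H => x; apply/funext => t; apply/val_inj/funext => r.
by rewrite HE /= -linearZ gE linearZ /= mul1r.
Qed.

End CoinducedModule.

(** One character of M for each nonzero element of M, not vanishing there,
    embeds M into a product of coinduced modules. *)
Lemma enough_injectives (R : pzRingType) (M : lmodType R) :
  exists (I : lmodType R) (i : {linear M -> I}),
  injective_module I /\ injective i.
Proof.
have [D [divD cogD]] := divisible_cogenerator.
have [chi chiP] : {chi : M -> {linear zmodule M -> D} &
    forall m : M, m <> 0 -> chi m m <> 0}.
  apply: (@choice _ _ (fun m (chi : {linear zmodule M -> D}) =>
    m <> 0 -> chi m <> 0)) => m.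
  have [->|/cogD[chi]] := pselect (m = 0); last by exists chi.
  by have [a u v|z _] := @linear_exists int (zmodule M) D (fun=> 0);
    [rewrite scaler0 addr0|exists z].
exists (M -> coinduced R D : lmodType R).
have addh t (x : M) : additive_pred (fun r : R => chi t (r *: x)).
  by apply/asboolP => a b; rewrite scalerDl raddfD.
pose h (x : M) t : coinduced R D := exist (fun f => additive_pred f) _ (addh t x).
have [a u v|i iE] := @linear_exists R M (M -> coinduced R D) h.
  apply/funext => t; apply/val_inj/funext => r /=.
  by rewrite scalerDr raddfD scalerA.
exists i; split; first exact: coinduced_injective.
apply: raddf_inj => m im0; apply: contrapT => /chiP; apply.
have -> : m = 1 *: m :> M by rewrite scale1r.
by have := iE m; rewrite im0 => /(congr1 (fun k => sval (k (1 *: m)) 1)) /= <-.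
Qed.

(** * Free modules and enough projective modules *)

Record free_module (R : pzRingType) (T : choiceType) := FreeModule {
  free_obj :> lmodType R;
  basis : T -> free_obj;
  coord : T -> {linear free_obj -> R^o};
  coord_basis : forall t u, coord t (basis u) = (t == u)%:R;
  coord_finite : forall x, exists s : seq T, [/\ uniq s,
    forall t, t \notin s -> coord t x = 0
    & x = \sum_(t <- s) (coord t x : R) *: basis t]
}.

Lemma sum_support (V : nmodType) (T : choiceType) (s s' : seq T) (F : T -> V) :
  uniq s -> uniq s' -> (forall t, t \notin s -> F t = 0) ->
  {subset s <= s'} -> \sum_(t <- s') F t = \sum_(t <- s) F t.
Proof.
move=> us us' F0 ss'; rewrite (bigID (fun t => t \in s)) /=.
rewrite [X in _ + X]big1 ?addr0; last by move=> t /F0.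
rewrite -big_filter; apply/perm_big/uniq_perm; rewrite ?filter_uniq // => t.
by rewrite mem_filter andb_idr //; apply: ss'.
Qed.

Lemma free_module_exists (R : pzRingType) (T : choiceType) :
  inhabited (free_module R T).
Proof.
pose finsupp (f : T -> R^o) := exists s : seq T, forall t, t \notin s -> f t = 0.
have [|L [i [inj_i im_i]]] := @submodule_exists R (T -> R^o) finsupp.
  split; first by exists [::].
  move=> a u v [s us] [s' us']; exists (s ++ s') => t.
  rewrite mem_cat negb_or => /andP[/us ut /us' vt].
  have -> : (a *: u + v) t = a *: u t + v t by [].
  by rewrite ut vt scaler0 addr0.
have [b bE] : {b : T -> L & forall t, i (b t) = fun u => (u == t)%:R}.
  apply: (@choice _ _ (fun t b => i b = fun u => (u == t)%:R)) => t; apply/im_i.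
  by exists [:: t] => u; rewrite inE => /negPf->.
have [c cE] : {c : T -> {linear L -> R^o} & forall t x, c t x = i x t}.
  apply: (@choice _ _ (fun t (c : {linear L -> R^o}) => forall x, c x = i x t)).
  by move=> t; apply: linear_exists => a u v; rewrite linearP.
have cb t u : c t (b u) = (t == u)%:R by rewrite cE bE.
apply: inhabits; apply: (@FreeModule R T L b c cb) => x.
have /im_i[s0 s0P] : exists k, i k = i x by exists x.
exists (undup s0); rewrite undup_uniq; split=> // [t|].
  by rewrite mem_undup => /s0P; rewrite cE.
apply: inj_i; apply/funext => t.
have iE (F : T -> L) (r : seq T) :
    i (\sum_(u <- r) F u) t = \sum_(u <- r) i (F u) t.
  by elim/big_rec2: _ => [|u y z _ <-]; rewrite ?linear0 ?linearD.
rewrite iE (eq_bigr (fun u => if u == t then i x u else 0)); last first.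
  move=> u _; rewrite linearZ cE bE; rewrite -[LHS]/(i x u * (t == u)%:R).
  by rewrite eq_sym; case: eqP => _; rewrite ?mulr1 ?mulr0.
rewrite -big_mkcond /= -big_filter; have [ts|tNs] := boolP (t \in undup s0).
  rewrite (perm_big [:: t]) /= ?big_seq1 //; apply: uniq_perm => // [|u].
    by rewrite filter_uniq ?undup_uniq.
  by rewrite mem_filter inE; case: eqP => // ->.
rewrite big_filter big1_seq; last by move=> u /andP[/eqP-> /(negP tNs)].
by apply: s0P; rewrite -mem_undup.
Qed.

Section FreeModuleTheory.
Variables (R : pzRingType) (T : choiceType) (L : free_module R T).

Lemma free_lift (V : lmodType R) (phi : T -> V) :
  exists h : {linear L -> V}, forall t, h (basis L t) = phi t.
Proof.
have [s sP] := choice (@coord_finite R T L).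
pose h x := \sum_(t <- s x) (coord L t x : R) *: phi t.
have hE x s' : uniq s' -> {subset s x <= s'} ->
    h x = \sum_(t <- s') (coord L t x : R) *: phi t.
  have [us s0 _] := sP x; move=> us' ss'; apply/esym/sum_support => // t /s0 ->.
  exact: scale0r.
have [a u v|H HE] := @linear_exists R L V h.
  pose s' := undup (s (a *: u + v) ++ s u ++ s v).
  rewrite !(@hE _ s') ?undup_uniq //; try by move=> t;
    rewrite mem_undup !mem_cat => ->; rewrite ?orbT.
  rewrite scaler_sumr -big_split /=; apply: eq_bigr => t _.
  by rewrite linearP scalerDl scalerA.
exists H => t; rewrite HE (@hE _ (undup (t :: s (basis L t)))) ?undup_uniq //.
  rewrite (@sum_support _ _ [:: t]) ?undup_uniq //.
  - by rewrite big_seq1 coord_basis eqxx scale1r.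
  - by move=> u; rewrite inE coord_basis => /negPf->; rewrite scale0r.
  - by move=> u; rewrite mem_undup !inE => ->.
by move=> u; rewrite mem_undup inE => ->; rewrite orbT.
Qed.

Definition supported (S : T -> Prop) (x : L) :=
  forall t, coord L t x <> 0 -> S t.

Lemma eq_on_supported (S : T -> Prop) (V : lmodType R) (f g : {linear L -> V}) x :
  supported S x -> (forall t, S t -> f (basis L t) = g (basis L t)) -> f x = g x.
Proof.
move=> Sx fg; have [s [_ _ ->]] := coord_finite x.
rewrite !linear_sum; apply: eq_bigr => t _; rewrite !linearZ.
have [->|/Sx/fg->//] := pselect (coord L t x = 0).
exact: etrans (scale0r _) (esym (scale0r _)).
Qed.

Lemma eq_free (V : lmodType R) (f g : {linear L -> V}) :
  (forall t, f (basis L t) = g (basis L t)) -> forall x, f x = g x.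
Proof. by move=> fg x; apply: (@eq_on_supported (fun=> True)). Qed.

Lemma projective_free : projective L.
Proof.
move=> A B g f surj_g.
have [phi phiE] := choice (fun t => surj_g (f (basis L t))).
have [h hE] := free_lift phi; exists h.
by apply: (@eq_free B (g \o h) f) => t /=; rewrite hE.
Qed.

End FreeModuleTheory.

Lemma enough_projectives (R : pzRingType) (M : lmodType R) :
  exists (P : lmodType R) (p : {linear P -> M}), projective P /\ surjective p.
Proof.
have [L] := free_module_exists R M; have [p pE] := free_lift L (fun m : M => m).
exists L, p; split; first exact: projective_free.
by move=> m; exists (basis L m).
Qed.

(** * Vanishing of Ext^1 as an extension property *)

Record syzygy (R : pzRingType) (M : lmodType R) := Syzygy {
  cover : lmodType R;
  syz : lmodType R;
  syz_incl : {linear syz -> cover};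
  cover_map : {linear cover -> M};
  cover_projective : projective cover;
  syz_exact : short_exact syz_incl cover_map
}.

Lemma syzygy_exists (R : pzRingType) (M : lmodType R) :
  inhabited (syzygy M).
Proof.
have [P [p [projP surj_p]]] := enough_projectives M.
have [K [i [inj_i ex_i]]] := kernel_exists p.
exact: (inhabits (@Syzygy R M P K i p projP (And3 inj_i ex_i surj_p))).
Qed.

Lemma exact_at_compr (R : pzRingType) (A B C D : lmodType R)
    (q : {linear A -> B}) (f : {linear B -> C}) (g : {linear C -> D}) :
  surjective q -> exact_at f g -> exact_at (f \o q) g.
Proof.
move=> surj_q ex_fg y; rewrite ex_fg; split=> [[b <-]|[a <-]]; last by exists (q a).
by have [a <-] := surj_q b; exists a.
Qed.

Lemma exact_at_compl (R : pzRingType) (A B C D : lmodType R)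
    (f : {linear A -> B}) (g : {linear B -> C}) (j : {linear C -> D}) :
  injective j -> exact_at f g -> exact_at f (j \o g).
Proof.
move=> inj_j ex_fg y; rewrite -ex_fg /=; split=> [|->]; last exact: linear0.
by rewrite -[RHS](linear0 j) => /inj_j.
Qed.

Lemma resolution_exists (R : pzRingType) (M : lmodType R) :
  inhabited (proj_resolution M).
Proof.
pose S (N : lmodType R) : syzygy N := inhabited_witness (syzygy_exists N).
pose K n : lmodType R := iter n (fun N => syz (S N)) M.
pose P n := cover (S (K n)).
pose p n : {linear P n -> K n} := cover_map (S (K n)).
pose i n : {linear K n.+1 -> P n} := syz_incl (S (K n)).
pose d n : {linear P n.+1 -> P n} := i n \o p n.+1.
have sesP n : short_exact (i n) (p n) := syz_exact (S (K n)).
apply: inhabits; apply: (@ProjResolution R M P d (p 0%N)).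
- by move=> n; apply: cover_projective.
- by case: (sesP 0%N).
- have [_ ex_0 _] := sesP 0%N; have [_ _ surj_1] := sesP 1%N.
  exact: exact_at_compr surj_1 ex_0.
- move=> n; have [inj_n _ _] := sesP n; have [_ ex_n _] := sesP n.+1.
  have [_ _ surj_n] := sesP n.+2.
  exact/(exact_at_compr surj_n)/(exact_at_compl inj_n ex_n).
Qed.

(** Splicing a short exact sequence onto a resolution of its kernel shifts the
    cohomology by one degree, definitionally; this is dimension shifting. *)
Section ResolutionCons.
Variables (R : pzRingType) (K P M : lmodType R).
Variables (i : {linear K -> P}) (p : {linear P -> M}).
Hypotheses (projP : projective P) (ses : short_exact i p).
Variable Q : proj_resolution K.

Definition cons_obj n : lmodType R :=
  if n is n'.+1 then res_obj Q n' else P.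

Definition cons_d n : {linear cons_obj n.+1 -> cons_obj n} :=
  match n with
  | 0 => (i \o res_aug Q : {linear res_obj Q 0 -> P})
  | n'.+1 => res_d Q n'
  end.

Lemma cons_projective n : projective (cons_obj n).
Proof. by case: n => [|n]; [apply: projP|apply: res_projective]. Qed.

Lemma cons_exact0 : exact_at (cons_d 0) p.
Proof.
by have [_ ex_i _] := ses; apply: exact_at_compr ex_i; apply: res_aug_surj.
Qed.

Lemma cons_exactS n : exact_at (cons_d n.+1) (cons_d n).
Proof.
case: n => [|n]; last exact: res_exactS.
by have [inj_i _ _] := ses; apply: exact_at_compl inj_i (@res_exact0 R K Q).
Qed.

Definition resolution_cons : proj_resolution M :=
  let: And3 _ _ surj_p := ses in
  ProjResolution cons_projective surj_p cons_exact0 cons_exactS.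

End ResolutionCons.

(** Vanishing of Ext^1 as an extension property, for all presentations of [A] and
    not only those by projectives; unlike the definition through resolutions, it
    can be used on any short exact sequence at hand. *)
Definition ext1_zero (R : pzRingType) (A Y : lmodType R) :=
  forall (K L : lmodType R) (i : {linear K -> L}) (p : {linear L -> A}),
  short_exact i p -> forall f : {linear K -> Y},
  exists g : {linear L -> Y}, forall x, g (i x) = f x.

(** A presentation by a projective maps to every other presentation [L], and [L]
    is the pushout of the projective along the induced map of kernels, so maps
    out of [L] can be defined from compatible maps out of [P] and [K']. *)
Lemma ext1_zero_cover (R : pzRingType) (A Y K P : lmodType R)
    (i : {linear K -> P}) (p : {linear P -> A}) :
  projective P -> short_exact i p ->
  (forall f : {linear K -> Y}, exists g : {linear P -> Y},
     forall x, g (i x) = f x) ->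
  ext1_zero A Y.
Proof.
move=> projP [inj_i ex_i surj_p] extP K' L i' p' [inj_i' ex_i' surj_p'] f.
have [b bE] := projP _ _ p' p surj_p'.
have [x|bK bKE] := @factor_inj R K K' L i' (b \o i) inj_i'.
  by apply/ex_i'; rewrite /= bE; apply/ex_i; exists x.
have [g gE] := extP (f \o bK).
have [x|a _ _ _ _ [l [k [-> ->]]] [l' [k' [-> ->]]]|y|h hE] :=
  @linear_of_graph R L Y
    (fun x y => exists l k, x = b l + i' k /\ y = g l + f k).
- have [l e] := surj_p (p' x); have /ex_i'[k def_k] : p' (x - b l) = 0.
    by rewrite linearB bE e subrr.
  by exists (g l + f k), l, k; split=> //; rewrite def_k addrC subrK.
- exists (a *: l + l'), (a *: k + k'); rewrite !linearP.
  by split; rewrite scalerDr addrACA.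
- case=> l [k [e ->]]; have /ex_i[m def_l] : p l = 0.
    have p'i'k : p' (i' k) = 0 by apply/ex_i'; exists k.
    by rewrite -bE -[p' _]addr0 -{1}p'i'k -linearD -e linear0.
  have : i' (bK m + k) = i' 0 by rewrite linearD bKE /= def_l -e linear0.
  move/inj_i'/eqP; rewrite addr_eq0 => /eqP def_m.
  have := gE m; rewrite /= def_m def_l => ->.
  by rewrite linearN addNr.
exists h => x; apply/hE; exists 0, x.
by rewrite !linear0 !add0r.
Qed.

Lemma Ext1P (R : pzRingType) (A Y : lmodType R) :
  Ext_zero 1 A Y <-> ext1_zero A Y.
Proof.
split=> [extAY|ext_lift Q f fd].
  have [[P K i p projP sesP]] := syzygy_exists A.
  have [Q] := resolution_exists K.
  apply: (ext1_zero_cover projP sesP) => f.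
  have := extAY (resolution_cons projP sesP Q).
  case: sesP => inj_i ex_i surj_p; case/(_ (f \o res_aug Q)) => [x|g gE].
    by rewrite /= (_ : res_aug Q _ = 0) ?linear0 //; apply/res_exact0; exists x.
  by exists g => x; have [y <-] := @res_aug_surj R K Q x; rewrite -gE.
have [K [i [inj_i ex_i]]] := kernel_exists (res_aug Q).
have [x|q qE] := @factor_inj R _ K _ i (res_d Q 0) inj_i.
  by apply/ex_i/res_exact0; exists x.
have surj_q : surjective q.
  move=> k; have /res_exact0[x def_x] : res_aug Q (i k) = 0 by apply/ex_i; exists k.
  by exists x; apply: inj_i; rewrite qE.
have [x qx0|f' f'E] := @factor_surj R _ K Y q f surj_q.
  have /res_exactS[y <-] : res_d Q 0 x = 0 by rewrite -qE qx0 linear0.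
  exact: fd.
have [g gE] := ext_lift _ _ i _ (And3 inj_i ex_i (@res_aug_surj R A Q)) f'.
by exists g => x; rewrite -f'E -gE qE.
Qed.

Lemma Ext_zero_syzygy (R : pzRingType) (K P A Y : lmodType R)
    (i : {linear K -> P}) (p : {linear P -> A}) n :
  projective P -> short_exact i p ->
  Ext_zero n.+2 A Y -> Ext_zero n.+1 K Y.
Proof.
move=> projP ses extA Q; have := extA (resolution_cons projP ses Q).
by case: ses.
Qed.

(** Extend first over the preimage of [A] in [L], then over [L]. *)
Lemma ext1_zero_extension (R : pzRingType) (A B C Y : lmodType R)
    (u : {linear A -> B}) (v : {linear B -> C}) :
  short_exact u v -> ext1_zero A Y -> ext1_zero C Y -> ext1_zero B Y.
Proof.
move=> [inj_u ex_uv surj_v] extA extC K L i p [inj_i ex_i surj_p] f.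
have [K' [j [inj_j ex_j]]] := kernel_exists (v \o p).
have [x|i' i'E] := @factor_inj R K K' L j i inj_j.
  apply/ex_j => /=; have -> : p (i x) = 0 by apply/ex_i; exists x.
  exact: linear0.
have [x|p' p'E] := @factor_inj R K' A B u (p \o j) inj_u.
  by apply/ex_uv/ex_j; exists x.
have [|f' f'E] := extA _ _ i' p' _ f.
  split.
  - by move=> x y e; apply: inj_i; rewrite -!i'E e.
  - move=> y; split=> [py0|[x <-]].
      have /ex_i[x def_x] : p (j y) = 0 by rewrite -[LHS]p'E py0 linear0.
      by exists x; apply: inj_j; rewrite i'E.
    apply: inj_u; rewrite p'E /= i'E linear0; by apply/ex_i; exists x.
  - move=> a; have [l def_l] := surj_p (u a).
    have /ex_j[k def_k] : (v \o p) l = 0 by rewrite /= def_l; apply/ex_uv; exists a.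
    by exists k; apply: inj_u; rewrite p'E /= def_k.
have [|g gE] := extC _ _ j (v \o p) _ f'.
  split=> // c; have [b <-] := surj_v c; have [l <-] := surj_p b.
  by exists l.
by exists g => x; rewrite -i'E gE f'E.
Qed.

(** * Strongly FP-injective modules *)

Lemma cohomology_zero_injective (R : pzRingType) (X I : lmodType R)
    (Q : proj_resolution X) k : injective_module I -> cohomology_zero Q I k.+1.
Proof.
move=> injI f fd; have [x dx0|g gE] := injI _ _ (res_d Q k) f.
  have [y <-] : exists y, res_d Q k.+1 y = x by apply/res_exactS.
  exact: fd.
by exists g => x; rewrite gE.
Qed.

Lemma SFI_injective (R : pzRingType) (I : lmodType R) :
  injective_module I -> strongly_FP_injective I.
Proof. by move=> injI [|k] F // _ _ Q; apply: cohomology_zero_injective. Qed.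

Lemma SFI_vee_injective (R : pzRingType) n (I : lmodType R) :
  injective_module I -> SFI_vee n I.
Proof.
move=> injI; pose Z : lmodType R := 'rV[R]_0.
have Z0 (x : Z) : x = 0 by apply/matrixP => i [].
have SFI_Z : strongly_FP_injective Z.
  by apply: SFI_injective => A B d f _; exists \0 => x; rewrite [RHS]Z0.
pose E i : lmodType R := if i is 0 then I else Z.
exists E, idfun, (fun i => \0 : {linear E i -> E i.+1}).
split=> [[|i] _|x|x y|y|i _ y] //=.
- exact: SFI_injective.
- by split=> // _; exists y.
- by split=> // _; exists 0; rewrite [RHS]Z0.
Qed.

(** Ext^k(F, C) = Ext^(k+1)(F, E), written out on cocycles: a cocycle with values
    in [C] is lifted to [I], the failure [e] of the lift to be a cocycle has
    values in [E] and is a coboundary [u], and correcting by [u] gives a cocycle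
    with values in the injective [I]. *)
Lemma SFI_cosyzygy (R : pzRingType) (E I C : lmodType R)
    (i : {linear E -> I}) (p : {linear I -> C}) :
  injective_module I -> short_exact i p ->
  strongly_FP_injective E -> strongly_FP_injective C.
Proof.
move=> injI [inj_i ex_i surj_p] SFI_E [|k] F // _ fpF Q f fd.
have [h hE] := res_projective (p := Q) f surj_p.
have [x|e eE] := @factor_inj R _ E I i (h \o res_d Q k.+1) inj_i.
  by apply/ex_i; rewrite /= hE.
have [x|u uE] := SFI_E k.+2 F isT fpF Q e.
  apply: inj_i; rewrite eE /= linear0 -[RHS](linear0 h); congr (h _).
  by apply/res_exactS; exists x.
have [x dx0|v vE] := injI _ _ (res_d Q k) (h \- (i \o u)).
  have [y <-] : exists y, res_d Q k.+1 y = x by apply/res_exactS.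
  by rewrite /= -uE eE /= subrr.
exists (p \o v) => x; rewrite /= vE /= linearB hE.
by have -> : p (i (u x)) = 0; [apply/ex_i; exists (u x)|rewrite subr0].
Qed.

Lemma projective_row (R : pzRingType) n : projective 'rV[R]_n.
Proof.
move=> A B g f surj_g.
have [y yE] := choice (fun j : 'I_n => surj_g (f (delta_mx 0 j))).
have [a u v|h hE] := @linear_exists R 'rV[R]_n A (fun v => \sum_j v 0 j *: y j).
  rewrite scaler_sumr -big_split; apply: eq_bigr => j _.
  by rewrite !mxE scalerDl scalerA.
exists h => v; rewrite hE [in RHS](row_sum_delta v) !linear_sum.
by apply: eq_bigr => j _; rewrite !linearZ yE.
Qed.

(** Maps from the finitely presented module coker c to [Z] lift to [X]: the
    sequence ending with [p] is pure. *)
Definition fp_lifting (R : pzRingType) (X Z : lmodType R) (p : {linear X -> Z}) :=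
  forall a b (c : {linear 'rV[R]_a -> 'rV[R]_b}) (phi : {linear 'rV[R]_b -> Z}),
  (forall v, phi (c v) = 0) ->
  exists t : {linear 'rV[R]_b -> X},
    (forall v, p (t v) = phi v) /\ (forall v, t (c v) = 0).

Lemma SFI_fp_lifting (R : pzRingType) (E X Z : lmodType R)
    (i : {linear E -> X}) (p : {linear X -> Z}) :
  short_exact i p -> strongly_FP_injective E -> fp_lifting p.
Proof.
move=> [inj_i ex_i surj_p] SFI_E a b c phi phic.
have [F [q [ex_q surj_q]]] := cokernel_exists c.
have /Ext1P extF : Ext_zero 1 F E by apply: SFI_E => //; exists a, b, c, q.
have [h hE] := @projective_row R b _ _ p phi surj_p.
have [v|u uE] := @factor_inj R _ E X i (h \o c) inj_i.
  by apply/ex_i; rewrite /= hE.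
have [K [j [inj_j ex_j]]] := kernel_exists q.
have [v|c' c'E] := @factor_inj R _ K _ j c inj_j.
  by apply/ex_j/ex_q; exists v.
have surj_c' : surjective c'.
  move=> k; have /ex_q[v def_v] : q (j k) = 0 by apply/ex_j; exists k.
  by exists v; apply: inj_j; rewrite c'E.
have [v c'v|u' u'E] := @factor_surj R _ K E c' u surj_c'.
  by apply: inj_i; rewrite uE /= -c'E c'v !linear0.
have [w wE] := extF _ _ j q (And3 inj_j ex_j surj_q) u'.
exists (h \- (i \o w)); split=> v /=.
  rewrite linearB hE; have -> : p (i (w v)) = 0 by apply/ex_i; exists (w v).
  by rewrite subr0.
by rewrite -c'E wE u'E uE /= c'E subrr.
Qed.

(** * Null homotopies on complexes of finitely generated free modules *)

(** Exactness of Hom(F, X) at every X (n + 1) for F finitely presented, where F is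
    the cokernel of a map [c] between finitely generated free modules. *)
Definition pure_exact (R : pzRingType) (X : nat -> lmodType R)
    (d : forall n, {linear X n -> X n.+1}) :=
  (forall n x, d n.+1 (d n x) = 0) /\
  forall n a b (c : {linear 'rV[R]_a -> 'rV[R]_b})
    (phi : {linear 'rV[R]_b -> X n.+1}),
  (forall v, d n.+1 (phi v) = 0) -> (forall v, phi (c v) = 0) ->
  exists t : {linear 'rV[R]_b -> X n},
    (forall v, d n (t v) = phi v) /\ (forall v, t (c v) = 0).

Section FiniteNullHomotopy.
Variables (R : pzRingType) (X : nat -> lmodType R).
Variables (d : forall n, {linear X n -> X n.+1}) (a : nat -> nat).
Local Notation C n := 'rV[R]_(a n).
Variables (c : forall n, {linear C n -> C n.+1}).
Variables (f : forall n, {linear C n -> X n.+1}).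
Hypotheses (pure_d : pure_exact d) (cc0 : forall n x, c n.+1 (c n x) = 0).
Hypothesis fc : forall n x, f n.+1 (c n x) = d n.+1 (f n x).

(** A homotopy built from the left cannot be continued naively: that would ask
    to extend f - d s along c, which need not be injective on coker c0.  The
    way out is to alter [s] by a map vanishing on the image of [c0], which does
    not disturb the earlier degrees.  One degree up, d f has values in cycles and
    vanishes on the image of [c n], so it lifts to a map [sigma] that vanishes
    there too; there f - sigma has values in cycles and lifts to [tau].  Then
    f - d s - tau c is a map from coker c0 to cycles, which lifts to the
    alteration [t] of [s]. *)
Lemma homotopy_step n b (c0 : {linear 'rV[R]_b -> C n}) (s : {linear C n -> X n}) :
  (forall v, c n (c0 v) = 0) -> (forall v, f n (c0 v) = d n (s (c0 v))) ->
  exists (s' : {linear C n -> X n}) (tau : {linear C n.+1 -> X n.+1}),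
    (forall v, s' (c0 v) = s (c0 v)) /\
    (forall v, f n v = d n (s' v) + tau (c n v)).
Proof.
have [dd0 lift] := pure_d; move=> cc0' fs.
have [v|v|sigma [dsigma sigmac]] := lift n.+2 _ _ (c n) (d n.+2 \o f n.+1).
- exact: dd0.
- by rewrite /= fc dd0.
have [v|v|tau [dtau _]] :=
  lift n.+1 0%N _ (\0 : {linear 'rV[R]_0 -> _}) (f n.+1 \- sigma).
- by rewrite /= linearB dsigma subrr.
- exact: (linear0 (f n.+1 \- sigma)).
have [v|v|t [dt tc]] := lift n _ _ c0 (f n \- (d n \o s) \- (tau \o c n)).
- by rewrite /= !linearB dd0 subr0 dtau /= sigmac subr0 fc subrr.
- by rewrite /= cc0' linear0 fs subrr subr0.
exists (s \+ t), tau; split=> v /=; first by rewrite tc addr0.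
by rewrite linearD dt /= -addrA subrK addrC subrK.
Qed.

(** Iterating the step: the map chosen in degree n is altered once, in the next
    step, in a way that [agree] keeps invisible to the previous degree. *)
Lemma null_homotopy_row :
  exists u : forall n, {linear C n -> X n},
    forall n v, f n v = d n (u n v) + u n.+1 (c n v).
Proof.
pose P n : {linear C n -> X n} -> Prop :=
  if n is m.+1 then fun s => forall v, f m.+1 (c m v) = d m.+1 (s (c m v))
  else fun=> True.
pose agree n : {linear C n -> X n} -> {linear C n -> X n} -> Prop :=
  if n is m.+1 then fun s s' => forall v, s' (c m v) = s (c m v)
  else fun _ _ => True.
pose Q n (s : {linear C n -> X n}) (tau : {linear C n.+1 -> X n.+1}) :=
  exists s', agree n s s' /\ forall v, f n v = d n (s' v) + tau (c n v).
have [||u uP] := @dependent_choice _ P Q; first by exists \0.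
  move=> n s Ps; have [s' [tau [s's fE]]] : exists (s' : {linear C n -> X n})
      (tau : {linear C n.+1 -> X n.+1}),
      agree n s s' /\ forall v, f n v = d n (s' v) + tau (c n v).
    case: n s Ps => [|n] s Ps /=.
      have [v|v|s' [tau [_ fE]]] := @homotopy_step 0 0 \0 s; last by exists s', tau.
        by rewrite linear0.
      by rewrite !linear0.
    have [v|v|s' [tau []]] := @homotopy_step n.+1 _ (c n) s.
    - exact: cc0.
    - exact: Ps.
    - by exists s', tau.
  exists tau; split; last by exists s'.
  by move=> v; rewrite fc fE linearD pure_d.1 add0r.
have [s' s'P] : {s' : forall n, {linear C n -> X n} &
    forall n, agree n (u n) (s' n) /\
      forall v, f n v = d n (s' n v) + u n.+1 (c n v)}.
  by exists (fun n => sval (cid (uP n).2)) => n; apply: (svalP (cid (uP n).2)).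
exists s' => n v; rewrite (s'P n).2; congr (_ + _).
exact/esym/((s'P n.+1).1).
Qed.

End FiniteNullHomotopy.

(** * Null homotopies on complexes of free modules *)

Section FreeNullHomotopy.
Variables (R : pzRingType) (X : nat -> lmodType R).
Variables (d : forall n, {linear X n -> X n.+1}).
Variables (T : nat -> choiceType) (L : forall n, free_module R (T n)).
Variables (D : forall n, {linear L n -> L n.+1}).
Variables (g : forall n, {linear L n -> X n.+1}).
Hypotheses (pure_d : pure_exact d) (DD0 : forall n x, D n.+1 (D n x) = 0).
Hypothesis gD : forall n x, g n.+1 (D n x) = d n.+1 (g n x).

(** The basis elements in [S] span a subcomplex. *)
Definition stable (S : forall n, T n -> Prop) :=
  forall n t, S n t -> supported (S n.+1) (D n (basis (L n) t)).

Definition homotopy_on (S : forall n, T n -> Prop)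
    (s : forall n, {linear L n -> X n}) :=
  forall n t, S n t -> g n (basis (L n) t) =
    d n (s n (basis (L n) t)) + s n.+1 (D n (basis (L n) t)).

Lemma supportedP n (S : T n -> Prop) (x : L n) : supported S x ->
  exists s : seq (T n), (forall t, t \in s -> S t) /\
    x = \sum_(t <- s) (coord (L n) t x : R) *: basis (L n) t.
Proof.
move=> Sx; have [s [us s0 def_x]] := coord_finite x.
exists [seq t <- s | `[< S t >]]; split=> [t|].
  by rewrite mem_filter => /andP[/asboolP].
rewrite [LHS]def_x big_filter [RHS]big_mkcond; apply: eq_bigr => t _.
case: asboolP => // nSt; have -> : coord (L n) t x = 0 by apply: contrapT => /Sx.
exact: scale0r.
Qed.

Lemma stable_supported (S : forall n, T n -> Prop) : stable S ->
  forall n x, supported (S n) x -> supported (S n.+1) (D n x).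
Proof.
move=> stS n x /supportedP[s [sS ->]] t; rewrite !linear_sum => cDx.
apply: contrapT => nSt; apply: cDx; rewrite big1_seq // => u /andP[_ /sS/stS Su].
rewrite !linearZ; have -> : coord (L n.+1) t (D n (basis (L n) u)) = 0.
  by apply: contrapT => /Su.
exact: scaler0.
Qed.

Lemma homotopy_on_supported (S : forall n, T n -> Prop)
    (s : forall n, {linear L n -> X n}) : homotopy_on S s ->
  forall n x, supported (S n) x -> g n x = d n (s n x) + s n.+1 (D n x).
Proof.
move=> homS n x Sx.
pose h : {linear L n -> X n.+1} := (d n \o s n) \+ (s n.+1 \o D n).
by apply: (@eq_on_supported _ _ _ (S n) _ (g n) h x Sx); apply: homS.
Qed.

(** A homotopy over the subcomplex spanned by a stable set.  The maps are total,
    but only their values on that set count. *)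
Definition partial_homotopy := {S : forall n, T n -> Prop &
  {s : forall n, {linear L n -> X n} | stable S /\ homotopy_on S s}}.

Definition dom (h : partial_homotopy) : forall n, T n -> Prop := projT1 h.
Definition hmap (h : partial_homotopy) : forall n, {linear L n -> X n} :=
  sval (projT2 h).
Lemma dom_stable h : stable (dom h).
Proof. exact: (svalP (projT2 h)).1. Qed.
Lemma hmapP h : homotopy_on (dom h) (hmap h).
Proof. exact: (svalP (projT2 h)).2. Qed.

Definition extends (h h' : partial_homotopy) :=
  forall n t, dom h t ->
    dom h' t /\ hmap h n (basis (L n) t) = hmap h' n (basis (L n) t).

Lemma extends_refl h : extends h h.
Proof. by []. Qed.

Lemma extends_trans h1 h2 h3 : extends h1 h2 -> extends h2 h3 -> extends h1 h3.
Proof.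
by move=> h12 h23 n t /h12[/h23[h3t e2] e1]; split=> //; rewrite e1.
Qed.

(** The union of a chain: each basis element in it takes its value from any
    member of the chain whose domain contains it. *)
Lemma chain_bound (A : partial_homotopy -> Prop) :
  (forall h h', A h -> A h' -> extends h h' \/ extends h' h) ->
  exists h', forall h, A h -> extends h h'.
Proof.
move=> totA.
pose S n (t : T n) := exists2 h, A h & dom h t.
have [s sP] : exists s : forall n, {linear L n -> X n}, forall n h t, A h ->
    dom h t -> s n (basis (L n) t) = hmap h n (basis (L n) t).
  suff ex n : exists s : {linear L n -> X n}, forall h t, A h ->
      dom h t -> s (basis (L n) t) = hmap h n (basis (L n) t).
    by exists (fun n => sval (cid (ex n))) => n; apply: (svalP (cid (ex n))).
  have [phi phiP] : {phi : T n -> X n & forall t h, A h ->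
      dom h t -> phi t = hmap h n (basis (L n) t)}.
    apply: (@choice _ _ (fun t x => forall h, A h ->
      dom h t -> x = hmap h n (basis (L n) t))) => t.
    have [[h Ah ht]|nSt] := pselect (S n t); last first.
      by exists 0 => h Ah ht; case: nSt; exists h.
    exists (hmap h n (basis (L n) t)) => h' Ah' ht'.
    by case: (totA h h' Ah Ah') => [/(_ n t ht)[]|/(_ n t ht')[]].
  have [s sE] := free_lift (L n) phi; exists s => h t Ah ht.
  by rewrite sE (phiP t h).
have stS : stable S.
  by move=> n t [h Ah ht] u /(dom_stable ht) hu; exists h.
have homS : homotopy_on S s.
  move=> n t [h Ah ht]; rewrite (hmapP ht) (sP _ h) //; congr (_ + _).
  apply: (eq_on_supported (dom_stable ht)) => u hu.
  by rewrite (sP _ h).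
exists (existT _ S (exist _ s (conj stS homS))) => h Ah n t ht.
by split; [exists h|rewrite -(sP n h t)].
Qed.

(** The differential of a basis element involves finitely many basis elements, so
    the subcomplex generated by one basis element is finitely generated in each
    degree: degrees start at 0, and its bases are collected upwards from there. *)
Lemma finite_closure m (t0 : T m) : exists N : forall n, seq (T n),
  t0 \in N m /\ stable (fun n t => t \in N n).
Proof.
have [start t0start] : exists start : forall n, seq (T n), t0 \in start m.
  exists (fun n => match pselect (m = n) with
    left e => [:: eq_rect m (fun n => T n) t0 n e] | right _ => [::] end).
  by case: pselect => // e; rewrite (eq_axiomK e) /= mem_head.
have [supp suppP] : exists supp : forall n, T n -> seq (T n.+1),
    forall n t u, coord (L n.+1) u (D n (basis (L n) t)) <> 0 -> u \in supp n t.
  have ex n t : exists s : seq (T n.+1),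
      forall u, coord (L n.+1) u (D n (basis (L n) t)) <> 0 -> u \in s.
    have [s [_ s0 _]] := coord_finite (D n (basis (L n) t)).
    by exists s => u cu; apply: contraT => /s0.
  by exists (fun n t => sval (cid (ex n t))) => n t; apply: (svalP (cid (ex n t))).
pose N := fix N n : seq (T n) := match n with
  | 0 => start 0%N
  | n'.+1 => start n'.+1 ++ flatten [seq supp n' t | t <- N n']
  end.
exists N; split; first by case: m t0 t0start => [|m] t0 //= t0s; rewrite mem_cat t0s.
move=> n t Nt u /suppP ut /=; rewrite mem_cat; apply/orP; right.
by apply/flattenP; exists (supp n t) => //; apply: map_f.
Qed.

(** The quotient of the subcomplex spanned by [dom h] and [N] by the one spanned
    by [dom h] is the complex with basis [A], hence finitely generated free in
    each degree.  It is presented through the coordinate projection [p] and the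
    inclusion [i] of the span of [A], with differential p D i; the identities that
    make this a complex hold because [p] kills the span of [dom h]. *)
Section Extension.
Variables (h : partial_homotopy) (N : forall n, seq (T n)).
Hypothesis stable_N : stable (fun n t => t \in N n).

Let A n : seq (T n) := undup [seq t <- N n | ~~ `[< dom h t >]].
Local Notation C n := 'rV[R]_(size (A n)).
Let a n (k : 'I_(size (A n))) : T n := tnth (in_tuple (A n)) k.
Let S' n (t : T n) := dom h t \/ t \in N n.

Let memA n t : t \in A n = (t \in N n) && ~~ `[< dom h t >].
Proof. by rewrite mem_undup mem_filter andbC. Qed.

Let a_dom n k : ~ dom h (a (n := n) k).
Proof.
have : a k \in A n by apply: mem_tnth.
by rewrite memA => /andP[_ /asboolPn].
Qed.

Let stS' : stable S'.
Proof.
move=> n t [ht|Nt] u; first by move=> /(dom_stable ht); left.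
by move=> /(stable_N Nt); right.
Qed.

Let ex_proj n : exists p : {linear L n -> C n},
  forall x k, p x 0 k = coord (L n) (a k) x.
Proof.
have [c x y|p pE] :=
  @linear_exists R (L n) (C n) (fun x => \row_k coord (L n) (a k) x).
  by apply/rowP => k; rewrite !mxE linearP.
by exists p => x k; rewrite pE mxE.
Qed.
Let ex_incl n : exists i : {linear C n -> L n},
  forall v, i v = \sum_k v 0 k *: basis (L n) (a k).
Proof.
apply: linear_exists => c u v; rewrite scaler_sumr -big_split.
by apply: eq_bigr => k _; rewrite !mxE scalerDl scalerA.
Qed.
Let p n := sval (cid (ex_proj n)).
Let pE n : forall x k, p n x 0 k = coord (L n) (a k) x := svalP (cid (ex_proj n)).
Let i n := sval (cid (ex_incl n)).
Let iE n : forall v, i n v = \sum_k v 0 k *: basis (L n) (a k) :=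
  svalP (cid (ex_incl n)).

Let p_dom n x : supported (@dom h n) x -> p n x = 0.
Proof.
move=> hx; apply/rowP => k; rewrite pE mxE; apply: contrapT => /hx.
exact: a_dom.
Qed.

Let coord_ip n x t : coord (L n) t (i n (p n x)) =
  if t \in A n then coord (L n) t x else 0.
Proof.
rewrite iE linear_sum /=.
rewrite (eq_bigr (fun k => (coord (L n) (a k) x : R) * (t == a k)%:R)); last first.
  by move=> k _; rewrite linearZ coord_basis pE.
case: ifP => [tA|tNA].
  have [k def_t] : exists k, a k = t.
    by have /tnthP[k ->] : t \in in_tuple (A n) by []; exists k.
  rewrite (bigD1 k) //= def_t eqxx mulr1 big1 ?addr0 // => j jk.
  case: eqP => [e|]; last by rewrite mulr0.
  case/eqP: jk; apply/(tuple_uniqP (in_tuple (A n))); rewrite ?undup_uniq //.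
  exact: etrans (esym e) (esym def_t).
rewrite big1 // => k _; case: eqP => [def_t|]; last by rewrite mulr0.
by move: tNA; rewrite def_t mem_tnth.
Qed.

Let sub_ip n x : supported (@S' n) x -> supported (@dom h n) (x - i n (p n x)).
Proof.
move=> Sx t; rewrite linearB coord_ip memA.
have [ht|nht] := pselect (dom h t); first by rewrite asboolT.
rewrite (asboolF nht) /= andbT; case: ifP => [_|/negP tN]; first by rewrite subrr.
by rewrite subr0 => /Sx[].
Qed.

Let supp_i n v : supported (@S' n) (i n v).
Proof.
move=> t; rewrite iE linear_sum => ct.
have [|nNt] := pselect (t \in N n); [by right|case: ct; rewrite big1 // => k _].
rewrite linearZ coord_basis; case: eqP => [def_t|_]; last exact: mulr0.
have : a k \in A n by apply: mem_tnth.
by rewrite -def_t memA => /andP[].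
Qed.

(** The defect f' = g - (d s + s D) of the given homotopy is a chain map that
    vanishes on the span of [dom h], so it descends to the finitely generated
    quotient complex; a null homotopy of it there is the correction. *)
Lemma partial_homotopy_extend :
  exists h', extends h h' /\ forall n t, t \in N n -> dom h' t.
Proof.
pose c n : {linear C n -> C n.+1} := p n.+1 \o D n \o i n.
have [f' f'E] : exists f' : forall n, {linear L n -> X n.+1}, forall n x,
    f' n x = g n x - (d n (hmap h n x) + hmap h n.+1 (D n x)).
  by exists (fun n => g n \- ((d n \o hmap h n) \+ (hmap h n.+1 \o D n))).
have f'_dom n x : supported (@dom h n) x -> f' n x = 0.
  by move=> hx; rewrite f'E -(homotopy_on_supported (@hmapP h) hx) subrr.
have f'_ip n x : supported (@S' n) x -> f' n (i n (p n x)) = f' n x.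
  by move=> /sub_ip/f'_dom/eqP; rewrite linearB subr_eq0 => /eqP.
have pD_ip n x : supported (@S' n) x ->
    p n.+1 (D n (i n (p n x))) = p n.+1 (D n x).
  move=> /sub_ip/(stable_supported (@dom_stable h))/p_dom/eqP.
  by rewrite !linearB subr_eq0 => /eqP.
have f'D n x : f' n.+1 (D n x) = d n.+1 (f' n x).
  by rewrite !f'E gD DD0 linear0 addr0 linearB linearD pure_d.1 add0r.
have SDi n v : supported (@S' n.+1) (D n (i n v)).
    exact: (stable_supported stS' (@supp_i n v)).
have [n v|n v|u uE] := @null_homotopy_row R X d _ c (fun n => f' n \o i n) pure_d.
- by rewrite /c /= pD_ip // DD0 linear0.
- by rewrite /c /= f'_ip // f'D.
pose s' n : {linear L n -> X n} := hmap h n \+ (u n \o p n).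
have homS' : homotopy_on S' s'.
  move=> n t S't; have Sb : supported (@S' n) (basis (L n) t).
    move=> x; rewrite coord_basis; case: eqP => // ->; exact.
  have := uE n (p n (basis (L n) t)); rewrite /c /= f'_ip // pD_ip //.
  rewrite f'E => /eqP; rewrite subr_eq => /eqP->.
  by rewrite /s' /= linearD addrC addrACA.
exists (existT _ S' (exist _ s' (conj stS' homS'))); split=> [n t ht|n t Nt].
  split; first by left.
  rewrite /hmap /= /s' /= p_dom ?linear0 ?addr0 // => x; rewrite coord_basis.
  by case: eqP => // ->.
by right.
Qed.

End Extension.

(** A maximal partial homotopy is defined on every basis element, since the
    subcomplex generated by a missing one could be added. *)
Lemma null_homotopy_free : exists s : forall n, {linear L n -> X n},
  forall n x, g n x = d n (s n x) + s n.+1 (D n x).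
Proof.
have st0 : stable (fun n t => False) by [].
have hom0 : homotopy_on (fun n t => False) (fun n => \0) by [].
pose h0 : partial_homotopy := existT _ _ (exist _ _ (conj st0 hom0)).
have [|A h _ totA|h max_h] := @zorn_above _ extends h0 extends_refl.
- by move=> h1 h2 h3; apply: extends_trans.
- exact: chain_bound.
exists (hmap h) => n x; apply: (homotopy_on_supported (@hmapP h)) => t _.
have [N [Nt stN]] := finite_closure t.
have [h' [hh' Nh']] := partial_homotopy_extend h stN.
by have [] := max_h h' hh' n t (Nh' n t Nt).
Qed.

End FreeNullHomotopy.

(** * Exact complexes of projectives and strongly FP-injective modules *)

(** Projective terms P are retracts r i = 1 of free modules L.  The maps i e r
    make L a complex, because i e r i e r = i e e r = 0, and P is a retract of it
    as a complex. *)
Lemma null_homotopy_projective (R : pzRingType) (X P : nat -> lmodType R)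
    (d : forall n, {linear X n -> X n.+1}) (e : forall n, {linear P n -> P n.+1})
    (g : forall n, {linear P n -> X n.+1}) :
  pure_exact d -> (forall n, projective (P n)) ->
  (forall n x, e n.+1 (e n x) = 0) ->
  (forall n x, g n.+1 (e n x) = d n.+1 (g n x)) ->
  exists s : forall n, {linear P n -> X n},
    forall n x, g n x = d n (s n x) + s n.+1 (e n x).
Proof.
move=> pure_d projP ee0 ge.
pose L n : free_module R (P n) := inhabited_witness (free_module_exists R (P n)).
have ex_r n : exists r : {linear L n -> P n}, exists i : {linear P n -> L n},
    forall x, r (i x) = x.
  have [r rE] := free_lift (L n) (fun x : P n => x).
  have [|i iE] := projP n _ _ r idfun; last by exists r, i.
  by move=> x; exists (basis (L n) x).
pose r n := sval (cid (ex_r n)); pose i n := sval (cid (svalP (cid (ex_r n)))).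
have riK n x : r n (i n x) = x := svalP (cid (svalP (cid (ex_r n)))) x.
pose D n : {linear L n -> L n.+1} := i n.+1 \o e n \o r n.
have [n x|n x|s sE] := @null_homotopy_free R X d _ L D (fun n => g n \o r n) pure_d.
- by rewrite /D /= riK ee0 linear0.
- by rewrite /D /= riK ge.
exists (fun n => s n \o i n) => n x.
by have := sE n (i n x); rewrite /D /= !riK.
Qed.

Record cosyzygy (R : pzRingType) (M : lmodType R) := Cosyzygy {
  envelope : lmodType R;
  cosyz : lmodType R;
  envelope_map : {linear M -> envelope};
  cosyz_proj : {linear envelope -> cosyz};
  envelope_injective : injective_module envelope;
  cosyz_exact : short_exact envelope_map cosyz_proj
}.

Lemma cosyzygy_exists (R : pzRingType) (M : lmodType R) :
  inhabited (cosyzygy M).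
Proof.
have [I [i [injI inj_i]]] := enough_injectives M.
have [C [p [ex_i surj_p]]] := cokernel_exists i.
exact: (inhabits (@Cosyzygy R M I C i p injI (And3 inj_i ex_i surj_p))).
Qed.

Section Coresolution.
Variables (R : pzRingType) (E : lmodType R).

Let S (N : lmodType R) : cosyzygy N := inhabited_witness (cosyzygy_exists N).
Let C n : lmodType R := iter n (fun N => cosyz (S N)) E.
Let i n : {linear C n -> envelope (S (C n))} := envelope_map (S (C n)).
Let p n : {linear envelope (S (C n)) -> C n.+1} := cosyz_proj (S (C n)).
Let ses n : short_exact (i n) (p n) := cosyz_exact (S (C n)).

(** The complex 0 -> E -> I^0 -> I^1 -> ... with all I^k injective.  The zero module
    in degree 0 makes the null homotopies below end with a map into E. *)
Definition coresolution n : lmodType R :=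
  match n with 0 => 'rV[R]_0 | 1 => E | m.+2 => envelope (S (C m)) end.

Definition coresolution_d n : {linear coresolution n -> coresolution n.+1} :=
  match n return {linear coresolution n -> coresolution n.+1} with
  | 0 => \0
  | 1 => i 0
  | m.+2 => i m.+1 \o p m
  end.

Lemma coresolution_injective n : injective_module (coresolution n.+2).
Proof. exact: envelope_injective. Qed.

Lemma coresolution_pure : strongly_FP_injective E -> pure_exact coresolution_d.
Proof.
move=> SFI_E; have SFI_C n : strongly_FP_injective (C n).
  elim: n => // n IHn.
  exact: (SFI_cosyzygy (@envelope_injective _ _ (S (C n))) (ses n) IHn).
have pi0 n x : p n (i n x) = 0 by have [_ ex_n _] := ses n; apply/ex_n; exists x.
split=> [[|[|n]] x|[|[|n]] a b c phi dphi phic] /=.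
- exact: linear0.
- by rewrite pi0 linear0.
- by rewrite pi0 linear0.
- exists \0; split=> v //=; have [inj_0 _ _] := ses 0.
  by apply: inj_0; rewrite [RHS]dphi linear0.
- have [inj_0 ex_0 _] := ses 0; have [inj_1 _ _] := ses 1.
  have [v|t tE] := @factor_inj R _ E _ (i 0) phi inj_0.
    by apply/ex_0/inj_1; rewrite linear0; apply: dphi.
  by exists t; split=> v; rewrite ?tE //; apply: inj_0; rewrite tE phic linear0.
- have [inj_2 ex_2 _] := ses n.+2; have [inj_1 ex_1 _] := ses n.+1.
  have [v|psi psiE] := @factor_inj R _ (C n.+1) _ (i n.+1) phi inj_1.
    by apply/ex_1/inj_2; rewrite linear0; apply: dphi.
  have [v|t [tE tc]] := SFI_fp_lifting (ses n) (SFI_C n) (c := c) (phi := psi).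
    by apply: inj_1; rewrite psiE phic linear0.
  by exists t; split=> v //; rewrite tE psiE.
Qed.

End Coresolution.

(** The given map, seen in degree 0, extends to a chain map from P to the injective
    coresolution of E, one degree at a time by injectivity.  A null homotopy of
    it consists of 0 and the required extension in the lowest degree. *)
Lemma projective_complex_SFI (R : pzRingType) (P : nat -> lmodType R)
    (e : forall n, {linear P n -> P n.+1})
    (E : lmodType R) (f : {linear P 0%N -> E}) :
  (forall n, projective (P n)) -> (forall n, exact_at (e n) (e n.+1)) ->
  strongly_FP_injective E -> (forall x, e 0%N x = 0 -> f x = 0) ->
  exists g : {linear P 1%N -> E}, forall x, f x = g (e 0%N x).
Proof.
move=> projP ex_e SFI_E ker_ef.
have pure_d := coresolution_pure SFI_E; pose d := @coresolution_d R E.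
pose X := @coresolution R E.
have ee0 n x : e n.+1 (e n x) = 0 by apply/ex_e; exists x.
have [||g gP] := @dependent_choice (fun n => {linear P n -> X n.+1})
  (fun n g => (forall x, e n x = 0 -> d n.+1 (g x) = 0) /\
    match n return {linear P n -> X n.+1} -> Prop with
    | 0 => fun g => forall x, g x = f x | _ => fun _ => True end g)
  (fun n g g' => forall x, g' (e n x) = d n.+1 (g x)).
- by exists f; split=> // x /ker_ef ->; apply: linear0.
- move=> n g [gP _].
  have [x /gP//|g' g'E] := @coresolution_injective R E n _ _ (e n) (d n.+1 \o g).
  exists g'; split=> //; split=> // _ /ex_e[x <-].
  by rewrite g'E; apply: pure_d.1.
have [n x|s sE] := null_homotopy_projective (g := g) pure_d projP ee0.
  by have [_ ->] := gP n.
exists (s 1%N) => x; have [[_ gf] _] := gP 0%N.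
by rewrite -gf sE /= add0r.
Qed.

Lemma finite_coresolutionS (R : pzRingType) (W : modclass R) n (Y : lmodType R) :
  finite_coresolution W n.+1 Y ->
  exists (E Y' : lmodType R) (i : {linear Y -> E}) (p : {linear E -> Y'}),
  [/\ W E, finite_coresolution W n Y' & short_exact i p].
Proof.
case=> E [i [d [WE E0 inj_i ex_i ex_d]]].
have [K [j [inj_j ex_j]]] := kernel_exists (d 1%N).
have [x|p pE] := @factor_inj R _ K _ j (d 0%N) inj_j.
  by apply/ex_j/ex_d => //; exists x.
exists (E 0%N), K, i, p; split; first exact: WE.
  exists (fun k => E k.+1), j, (fun k => d k.+1); split=> //.
  - by move=> k kn; apply: WE k.+1 kn.
  - by move=> k kn; apply: ex_d.
split=> // [y|k].
  rewrite -ex_i -pE; split=> [->|]; first exact: linear0.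
  by rewrite -[RHS](linear0 j) => /inj_j.
have /ex_d[//|x def_x] : d 1%N (j k) = 0 by apply/ex_j; exists k.
by exists x; apply: inj_j; rewrite pE.
Qed.

Lemma finite_coresolution0 (R : pzRingType) (W : modclass R) (Y : lmodType R) :
  finite_coresolution W 0 Y ->
  exists (E : lmodType R) (i : {linear Y -> E}),
  [/\ W E, injective i & surjective i].
Proof.
case=> E [i [d [WE E0 inj_i ex_i _]]]; exists (E 0%N), i; split=> //.
  exact: WE.
by move=> x; apply/ex_i/E0.
Qed.

(** Dimension shifting along 0 -> Y -> E -> Y' -> 0: extend the map to [E]; what it
    induces with values in [Y'] extends one degree further by induction and
    lifts back to [E] by projectivity, and the difference has values in [Y]. *)
Lemma projective_complex_SFI_vee (R : pzRingType) n (P : nat -> lmodType R)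
    (e : forall k, {linear P k -> P k.+1})
    (Y : lmodType R) (f : {linear P 0%N -> Y}) :
  (forall k, projective (P k)) -> (forall k, exact_at (e k) (e k.+1)) ->
  SFI_vee n Y -> (forall x, e 0%N x = 0 -> f x = 0) ->
  exists g : {linear P 1%N -> Y}, forall x, f x = g (e 0%N x).
Proof.
elim: n P e Y f => [|n IHn] P e Y f projP ex_e.
  case/finite_coresolution0 => E [i [SFI_E inj_i surj_i]] ker_ef.
  have [x /ker_ef fx0|g gE] :=
    projective_complex_SFI (f := i \o f) projP ex_e SFI_E.
    by rewrite /= fx0 linear0.
  have [x|h hE] := @factor_inj R _ Y E i g inj_i; first exact: surj_i.
  by exists h => x; apply: inj_i; rewrite hE -gE.
case/finite_coresolutionS => E [Y' [i [p [SFI_E Y'vee ses]]]] ker_ef.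
have [inj_i ex_i surj_p] := ses.
have [x /ker_ef fx0|g gE] :=
  projective_complex_SFI (f := i \o f) projP ex_e SFI_E.
  by rewrite /= fx0 linear0.
have [x e1x|h hE] := IHn (fun k => P k.+1) (fun k => e k.+1) Y' (p \o g)
    (fun k => projP k.+1) (fun k => ex_e k.+1) Y'vee.
  have [y <-] : exists y, e 0%N y = x by apply/ex_e.
  by rewrite /= -gE; apply/ex_i; exists (f y).
have [u uE] := projP 2 _ _ p h surj_p.
have [x|w wE] := @factor_inj R _ Y E i (g \- (u \o e 1%N)) inj_i.
  by apply/ex_i; rewrite /= linearB uE -hE subrr.
exists w => x; apply: inj_i; rewrite wE /= -gE.
have -> : e 1%N (e 0%N x) = 0 by apply/ex_e; exists x.
by rewrite linear0 subr0.
Qed.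

(** * Gorenstein projective modules and projective cotorsion pairs *)

(** M is a cokernel in an exact complex of projectives, and Hom(-, Y) keeps that
    complex exact. *)
Lemma Gorenstein_projective_ext1 (R : pzRingType) n (M Y : lmodType R) :
  Gorenstein_projective M -> SFI_vee n Y -> ext1_zero M Y.
Proof.
case=> P [d [projP ex_d _ [k0 [j0 jP]]]] veeY.
have [k def_k0] : exists k, k0 = k + 1 + 1 by exists (k0 - 1 - 1); rewrite !subrK.
subst k0; have [inj_j ex_j] := jP; rename j0 into j.
have [x|p pE] := @factor_inj R _ M _ j (d (k + 1)) inj_j.
  by apply/ex_j/ex_d; exists x.
have surj_p : surjective p.
  move=> m; have /ex_d[x def_x] : d (k + 1 + 1) (j m) = 0 by apply/ex_j; exists m.
  by exists x; apply: inj_j; rewrite pE.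
have [K [i [inj_i ex_i]]] := kernel_exists p.
apply: (ext1_zero_cover (projP (k + 1)) (And3 inj_i ex_i surj_p)) => f.
have [x|q qE] := @factor_inj R _ K _ i (d k) inj_i.
  by apply/ex_i/inj_j; rewrite pE linear0; apply/ex_d; exists x.
(* The complex from degree k on.  Iterating the shift makes the degree of the
   m.+1-st term literally one more than that of the m-th, as [d] requires. *)
pose idx m : int := iter m (fun l => l + 1) k.
have [x dx0|g gE] := projective_complex_SFI_vee (P := fun m => P (idx m))
  (e := fun m => d (idx m)) (f := f \o q)
  (fun m => projP (idx m)) (fun m => ex_d (idx m)) veeY.
  rewrite -[LHS]/(f (q x)).
  suff -> : q x = 0 by rewrite linear0.
  by apply: inj_i; rewrite qE linear0.
exists g => y; have /ex_d[x def_x] : d (k + 1) (i y) = 0.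
  by rewrite -pE; suff -> : p (i y) = 0; [rewrite linear0|apply/ex_i; exists y].
have <- : q x = y by apply: inj_i; rewrite qE.
by rewrite qE -[RHS]/((f \o q) x) gE.
Qed.

Section ProjectiveCotorsionPair.
Variables (R : pzRingType) (F W : modclass R).
Hypothesis projFW : projective_cotorsion_pair F W.
Hypothesis injW : forall I : lmodType R, injective_module I -> W I.
Hypothesis syzF : forall (K P M : lmodType R)
  (i : {linear K -> P}) (p : {linear P -> M}),
  projective P -> short_exact i p -> F M -> F K.

Let F_ext1 M : F M <-> forall Y, W Y -> ext1_zero M Y.
Proof.
by have [[F_perp _] _ _ _] := projFW; rewrite F_perp; split=> FM Y /FM/Ext1P.
Qed.

(** Salce's argument: embed M into an injective I with cokernel C, and pull back
    along a special precover B -> A -> C.  The pullback X is an extension of I by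
    B, hence in W, and of A by M, hence in F; so it is projective. *)
Lemma projective_embedding (M : lmodType R) : F M ->
  exists (P M' : lmodType R) (i : {linear M -> P}) (p : {linear P -> M'}),
  [/\ projective P, F M' & short_exact i p].
Proof.
have [_ complFW [_ thickW] FW_proj] := projFW; move=> FM.
have [[I C i p injI [inj_i ex_i surj_p]]] := cosyzygy_exists M.
have [B [A [f [g [WB FA [inj_f ex_f surj_g]]]]]] := complFW C.
have [a [x y] [x' y']|h hE] :=
    @linear_exists R (I * A)%type C (fun xy => p xy.1 - g xy.2).
  by rewrite /= [p _]linearP [g _]linearP scalerBr opprD addrACA.
have [X [u [inj_u ex_u]]] := kernel_exists h.
have uP z : p (u z).1 = g (u z).2.
  have /eqP : h (u z) = 0 by apply/ex_u; exists z.
  by rewrite hE subr_eq0 => /eqP.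
have ex_uP x y : p x = g y -> exists z, u z = (x, y).
  by move=> pg; apply/ex_u; rewrite hE pg subrr.
have [a z z'|prI prIE] := @linear_exists R X I (fun z => (u z).1).
  by rewrite linearP.
have [a z z'|prA prAE] := @linear_exists R X A (fun z => (u z).2).
  by rewrite linearP.
have [a m m'|iM0 iM0E] := @linear_exists R M (I * A)%type (fun m => (i m, 0)).
  by rewrite linearP; congr (_, _); rewrite /= scaler0 addr0.
have [a b b'|iB0 iB0E] := @linear_exists R B (I * A)%type (fun b => (0, f b)).
  by rewrite linearP; congr (_, _); rewrite /= scaler0 addr0.
have pi0 m : p (i m) = 0 by apply/ex_i; exists m.
have gf0 b : g (f b) = 0 by apply/ex_f; exists b.
have [m|iM iME] := @factor_inj R M X _ u iM0 inj_u.
  by rewrite iM0E; apply: ex_uP; rewrite pi0 linear0.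
have [b|iB iBE] := @factor_inj R B X _ u iB0 inj_u.
  by rewrite iB0E; apply: ex_uP; rewrite gf0 linear0.
have sesM : short_exact iM prA.
  split=> [m m' e|z|y].
  - have : u (iM m) = u (iM m') by rewrite e.
    by rewrite !iME !iM0E => -[] /inj_i.
  - rewrite prAE; split=> [u2|[m <-]]; last by rewrite iME iM0E.
    have /ex_i[m def_m] : p (u z).1 = 0 by rewrite uP u2 linear0.
    exists m; apply: inj_u; rewrite iME iM0E [RHS]surjective_pairing u2.
    by rewrite def_m.
  - have [x pg] := surj_p (g y); have [z uz] := ex_uP x y pg.
    by exists z; rewrite prAE uz.
have sesB : short_exact iB prI.
  split=> [b b' e|z|x].
  - have : u (iB b) = u (iB b') by rewrite e.
    by rewrite !iBE !iB0E => -[] /inj_f.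
  - rewrite prIE; split=> [u1|[b <-]]; last by rewrite iBE iB0E.
    have /ex_f[b def_b] : g (u z).2 = 0 by rewrite -uP u1 linear0.
    exists b; apply: inj_u; rewrite iBE iB0E [RHS]surjective_pairing u1.
    by rewrite def_b.
  - have [y pg] := surj_g (p x); have [z uz] := ex_uP x y (esym pg).
    by exists z; rewrite prIE uz.
exists X, A, iM, prA; split=> //; apply/FW_proj; split.
  apply/F_ext1 => Y WY; apply: (ext1_zero_extension sesM).
    by move/F_ext1: FM; apply.
  by move/F_ext1: FA; apply.
by have [_ WX _] := thickW _ _ _ _ _ sesB; apply/WX/injW.
Qed.

(** Splice projective covers to the left and projective embeddings to the right.
    All cycles are in F and projectives are in W, so Hom(-, Q) stays exact for
    projective Q. *)
Lemma Gorenstein_projective_of_cotorsion (M : lmodType R) :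
  F M -> Gorenstein_projective M.
Proof.
move=> FM; pose St := {N : lmodType R | F N}.
pose step (K K' : lmodType R) := exists (P : lmodType R) (i : {linear K -> P})
  (p : {linear P -> K'}), projective P /\ short_exact i p.
have [next nextP] : {next : St -> St & forall N, step (sval N) (sval (next N))}.
  apply: (@choice _ _ (fun N N' : St => step (sval N) (sval N'))) => -[N FN].
  have [P [N' [i [p [projP FN' ses]]]]] := projective_embedding FN.
  by exists (exist _ N' FN'), P, i, p.
have [prev prevP] : {prev : St -> St & forall N, step (sval (prev N)) (sval N)}.
  apply: (@choice _ _ (fun N N' : St => step (sval N') (sval N))) => -[N FN].
  have [[P K i p projP ses]] := syzygy_exists N.
  by exists (exist _ K (syzF projP ses FN)), P, i, p.
pose M0 : St := exist _ M FM.
pose K (l : int) : St :=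
  match l with Posz n => iter n next M0 | Negz n => iter n.+1 prev M0 end.
have stepK l : step (sval (K l)) (sval (K (l + 1))).
  case: l => [n|[|n]].
  - by rewrite -PoszD addn1; apply: nextP.
  - exact: prevP.
  - have -> : Negz n.+1 + 1 = Negz n.
      by rewrite !NegzE -[n.+2]addn1 PoszD opprD addrNK.
    exact: prevP.
pose P l := sval (cid (stepK l)).
pose j l : {linear sval (K l) -> P l} := sval (cid (svalP (cid (stepK l)))).
pose p l : {linear P l -> sval (K (l + 1))} :=
  sval (cid (svalP (cid (svalP (cid (stepK l)))))).
have stepP l : projective (P l) /\ short_exact (j l) (p l) :=
  svalP (cid (svalP (cid (svalP (cid (stepK l)))))).
pose d l : {linear P l -> P (l + 1)} := j (l + 1) \o p l.
exists P, d; split=> [l|l|Q l f projQ fd|].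
- exact: (stepP l).1.
- have [_ [_ _ surj_l]] := stepP l; have [_ [_ ex_l _]] := stepP (l + 1).
  have [_ [inj_l _ _]] := stepP (l + 1 + 1).
  exact/(exact_at_compr surj_l)/(exact_at_compl inj_l ex_l).
- have [_ [_ _ surj_0]] := stepP l; have [_ [_ ex_1 surj_1]] := stepP (l + 1).
  have [_ ses_2] := stepP (l + 1 + 1).
  have WQ : W Q by have [_ _ _ /(_ Q)[_]] := projFW; case/(_ projQ).
  have [x /ex_1[y <-]|f' f'E] := @factor_surj R _ _ Q (p (l + 1)) f surj_1.
    by have [z <-] := surj_0 y; apply: fd.
  have FK : F (sval (K (l + 1 + 1 + 1))) := svalP (K _).
  have [g gE] := (F_ext1 _).1 FK Q WQ _ _ _ _ ses_2 f'.
  by exists g => x; rewrite /d /= gE f'E.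
- exists 0, (j 0); have [_ [inj_0 ex_0 _]] := stepP 0; split=> //.
  by have [_ [inj_1 _ _]] := stepP (0 + 1); apply: exact_at_compl.
Qed.

End ProjectiveCotorsionPair.

Theorem theorem3p2 (R : pzRingType) (n : nat)
  (h : projective_cotorsion_pair (left_perp (@SFI_vee R n)) (@SFI_vee R n)) :
  [/\ cotorsion_pair (@Gorenstein_projective R)
        (right_perp (@Gorenstein_projective R)),
      hereditary_pair (@Gorenstein_projective R)
        (right_perp (@Gorenstein_projective R)),
      complete_pair (@Gorenstein_projective R)
        (right_perp (@Gorenstein_projective R)),
      eq_class (left_perp (@SFI_vee R n)) (@Gorenstein_projective R)
    & eq_class (@SFI_vee R n) (right_perp (@Gorenstein_projective R))].
Proof.
have [[F_perp W_perp] complFW _ _] := h.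
have FGP : eq_class (left_perp (@SFI_vee R n)) (@Gorenstein_projective R).
  move=> M; split.
    apply: (Gorenstein_projective_of_cotorsion h (@SFI_vee_injective R n)).
    move=> K P N i p projP ses FN [|k] B // _ WB.
    by apply: Ext_zero_syzygy projP ses _; apply: FN.
  move=> GM; apply/F_perp => Y WY; apply/Ext1P.
  exact: Gorenstein_projective_ext1 GM WY.
have WGP : eq_class (@SFI_vee R n) (right_perp (@Gorenstein_projective R)).
  move=> Y; split=> [WY i A i_gt0 /FGP FA|GY]; first exact: FA.
  by apply/W_perp => A /FGP; apply: GY.
split=> //.
- split=> M; split.
  + by move=> /FGP/F_perp GM Y /WGP; apply: GM.
  + by move=> GM; apply/FGP/F_perp => Y /WGP; apply: GM.
  + by move=> GM A; apply: GM.
  + by move=> GM; apply/WGP/W_perp => A /FGP; apply: GM.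
- by move=> i A B i_gt0 GA; apply.
- move=> M; have [B [A [f [g [WB FA ses]]]]] := complFW M.
  by exists B, A, f, g; split; [apply/WGP|apply/FGP|].
Qed.
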